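(* Let $\mathcal{P}$ be a graded poset for which there exists an adequate local covering family. Let $F_0=c_{\mathbb{Z}},F_1,F_2,\ldots$ be the associated sequence of functors $\mathcal{P}\to \mathrm{Ab}$ (see context). Then there exists a cochain complex $$0\rightarrow \prod_{p\in \mathrm{Ob}_0(\mathcal{P})} F_0(p)\xrightarrow{d_0}\prod_{p\in \mathrm{Ob}_1(\mathcal{P})} F_1(p) \xrightarrow{d_1} \prod_{p\in \mathrm{Ob}_2(\mathcal{P})} F_2(p)\xrightarrow{d_2} \cdots$$ whose cohomology is $H^*(\mathcal{P};\mathbb{Z})$.
   Context: Posets. A poset is regarded as a category $\mathcal{P}$ with exactly one arrow $p\to p'$ if $p\le p'$ and none otherwise. For $p<p'$, $p$ precedes $p'$ if $p\le p''\le p'$ implies $p''=p$ or $p''=p'$. $\mathcal{P}$ is graded if it is equipped with a degree function $\deg:\mathrm{Ob}(\mathcal{P})\to\mathbb{Z}$ which is order reversing and satisfies $\deg(p)=\deg(p')+1$ whenever $p$ precedes $p'$. Standing assumptions on every graded poset: $\{p\mid p_0\le p\}$ is finite for every $p_0$, and $\deg$ takes values in $\{0,1,2,\ldots\}$. $\mathrm{Ob}_n(\mathcal{P})$ is the set of objects of degree $n$. $(p_0\downarrow\mathcal{P})$, $(p_0\downarrow\mathcal{P})_*$, $(p_0\downarrow\mathcal{P})_n$ are the full subcategories (also used for their sets of objects) on $\{p\mid p_0\le p\}$, $\{p\mid p_0<p\}$, $\{p\mid p_0\le p,\ \deg p=n\}$. $c_{\mathbb{Z}}$ is the constant functor with value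 $\mathbb{Z}$, and $H^*(\mathcal{P};\mathbb{Z})=\varprojlim^* c_{\mathbb{Z}}$ (right derived functors of $\varprojlim:\mathrm{Ab}^{\mathcal{P}}\to\mathrm{Ab}$), which equals the integral cohomology of the realization $|\mathcal{P}|$. Local covering families. A family $\mathcal{J}=\{J^{p_0}_n\}_{p_0\in\mathrm{Ob}(\mathcal{P}),\,0\le n\le\deg(p_0)}$ with $J^{p_0}_n\subseteq(p_0\downarrow\mathcal{P})_n$ is a local covering family if (a) for each $p_0$ and $0\le n<\deg(p_0)$, $\bigcup_{p\in J^{p_0}_{n+1}}(p\downarrow\mathcal{P})_n=(p_0\downarrow\mathcal{P})_n$; (b) for each $p_0$, $0\le n<\deg(p_0)$ and $p\in J^{p_0}_{n+1}$, $J^p_n\subseteq J^{p_0}_n$. Define numbers $R^{p_0}_n$ for $\deg(p_0)\ge n$ by $R^{p_0}_0=1$ and $R^{p_0}_n=\sum_{p\in(p_0\downarrow\mathcal{P})_{n-1}}R^p_{n-1}-R^{p_0}_{n-1}$ for $n\ge1$. $\mathcal{J}$ is adequate if $(p_0\downarrow\mathcal{P})_*$ is connected whenever $\deg(p_0)\ge2$, and $R^{p_0}_n=\sum_{p\in J^{p_0}_n}R^p_n$ for all $n\ge0$ and $\deg(p_0)\ge n+1$. The functors $F_n$. $F_0=c_{\mathbb{Z}}$, and for $n\ge1$, $F_n(p_0)$ is the cokernel of the map $F_{n-1}(p_0)\to\prod_{p\in(p_0\downarrow\mathcal{P})_{n-1}}F_{n-1}(p)$ with components $F_{n-1}(p_0\to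 p)$; arrows act by the maps induced by the projections between the products. *)

(* Defs.v *)
From HB Require Import structures.
From Stdlib Require Import Relation_Operators.
From mathcomp Require Import all_boot all_order all_algebra.
From mathcomp Require Import boolp classical_sets functions cardinality fsbigop.

Set Implicit Arguments.
Unset Strict Implicit.
Unset Printing Implicit Defensive.

Import Order.TTheory GRing.Theory Num.Theory.

Local Open Scope classical_set_scope.
Local Open Scope ring_scope.

Section Additive.
Variables (U V : zmodType) (f : U -> V) (fB : zmod_morphism f).

Definition additive_of : {additive U -> V} :=
  HB.pack f (GRing.isZmodMorphism.Build U V f fB).

Lemma additive_ofE x : additive_of x = f x. Proof. by []. Qed.

End Additive.

Definition zmod_isom (U V : zmodType) : Prop :=
  exists f : {additive U -> V}, bijective f.

Section Product.
Variables (I : Type) (V : I -> zmodType).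

Definition product : Type := forall i, V i.

HB.instance Definition _ := gen_eqMixin product.
HB.instance Definition _ := gen_choiceMixin product.

Implicit Types x y z : product.

Let add x y : product := fun i => x i + y i.
Let opp x : product := fun i => - x i.
Let zero : product := fun i => 0.

Let addA : associative add.
Proof. by move=> x y z; apply: functional_extensionality_dep => i; apply: addrA. Qed.
Let addC : commutative add.
Proof. by move=> x y; apply: functional_extensionality_dep => i; apply: addrC. Qed.
Let add0 : left_id zero add.
Proof. by move=> x; apply: functional_extensionality_dep => i; apply: add0r. Qed.
Let addN : left_inverse zero opp add.
Proof. by move=> x; apply: functional_extensionality_dep => i; apply: addNr. Qed.

HB.instance Definition _ := GRing.isZmodule.Build product addA addC add0 addN.

Lemma product_ext x y : (forall i, x i = y i) -> x = y.
Proof. exact: functional_extensionality_dep. Qed.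

Lemma product0E i : (0 : product) i = 0. Proof. by []. Qed.
Lemma productDE x y i : (x + y) i = x i + y i. Proof. by []. Qed.
Lemma productNE x i : (- x) i = - x i. Proof. by []. Qed.
Lemma productBE x y i : (x - y) i = x i - y i. Proof. by []. Qed.

End Product.

Record subgroup (V : zmodType) := Subgroup {
  subgroup_set :> V -> Prop;
  subgroup0 : subgroup_set 0;
  subgroupB : forall x y,
    subgroup_set x -> subgroup_set y -> subgroup_set (x - y) }.

Definition subgroup_pred (V : zmodType) (S : subgroup V) : {pred V} :=
  fun x => `[< S x >].

Lemma subgroup_predP (V : zmodType) (S : subgroup V) x :
  reflect (S x) (x \in subgroup_pred S).
Proof. exact: asboolP. Qed.

Lemma subgroup_zmod_closed (V : zmodType) (S : subgroup V) :
  zmod_closed (subgroup_pred S).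
Proof.
split; first exact/subgroup_predP/subgroup0.
by move=> x y /subgroup_predP Sx /subgroup_predP Sy; apply/subgroup_predP/subgroupB.
Qed.

HB.instance Definition _ (V : zmodType) (S : subgroup V) :=
  GRing.isZmodClosed.Build V (subgroup_pred S) (subgroup_zmod_closed S).

Section SubgroupType.
Variables (V : zmodType) (S : subgroup V).

Record subgroup_type : Type := SubgroupElt {
  subgroup_val :> V;
  subgroup_valP : subgroup_val \in subgroup_pred S }.

HB.instance Definition _ := [isSub for subgroup_val].
HB.instance Definition _ := [Choice of subgroup_type by <:].
HB.instance Definition _ := [SubChoice_isSubZmodule of subgroup_type by <:].

Definition subgroup_elt x (Sx : S x) : subgroup_type :=
  @SubgroupElt x (introT (subgroup_predP S x) Sx).

Definition quotient : zmodType := Quotient.quot (subgroup_pred S).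

Definition to_quotient : {additive V -> quotient} := \pi_quotient%qT.

Lemma to_quotient_eq0 x : to_quotient x = 0 <-> S x.
Proof.
have -> : 0 = to_quotient 0 by rewrite raddf0.
split=> [/eqP|Sx]; last apply/eqP.
  by rewrite -Quotient.idealrBE subr0 => /subgroup_predP.
by rewrite -Quotient.idealrBE subr0; apply/subgroup_predP.
Qed.

Lemma to_quotient_surj q : exists x, to_quotient x = q.
Proof. by exists (repr q); rewrite /to_quotient /= reprK. Qed.

End SubgroupType.

Section QuotientMap.
Variables (U V : zmodType) (S : subgroup U) (T : subgroup V).
Variables (f : {additive U -> V}) (fS : forall x, S x -> T (f x)).

Let map (q : quotient S) : quotient T := to_quotient T (f (repr q)).

Let map_pi x : map (to_quotient S x) = to_quotient T (f x).
Proof.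
apply/eqP; rewrite -subr_eq0 -!raddfB; apply/eqP/to_quotient_eq0/fS.
apply/to_quotient_eq0; rewrite raddfB; apply/eqP; rewrite subr_eq0; apply/eqP.
by rewrite /to_quotient /= reprK.
Qed.

Let map_additive : zmod_morphism map.
Proof.
move=> q r; have [x <-] := to_quotient_surj q; have [y <-] := to_quotient_surj r.
by rewrite -raddfB !map_pi !raddfB.
Qed.

Definition quotient_map : {additive quotient S -> quotient T} :=
  additive_of map_additive.

Lemma quotient_mapE x : quotient_map (to_quotient S x) = to_quotient T (f x).
Proof. exact: map_pi. Qed.

End QuotientMap.

Section KernelImage.
Variables (U V : zmodType) (f : {additive U -> V}).

Let kernelB x y : f x = 0 -> f y = 0 -> f (x - y) = 0.
Proof. by move=> fx fy; rewrite raddfB fx fy subr0. Qed.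

Definition kernel : subgroup U :=
  @Subgroup U (fun x => f x = 0) (raddf0 f) kernelB.

Let image0 : exists x, f x = 0. Proof. by exists 0; apply: raddf0. Qed.
Let imageB y z :
  (exists x, f x = y) -> (exists x, f x = z) -> exists x, f x = y - z.
Proof. by move=> [a <-] [b <-]; exists (a - b); apply: raddfB. Qed.

Definition image : subgroup V :=
  @Subgroup V (fun y => exists x, f x = y) image0 imageB.

End KernelImage.

Record cochain_complex := CochainComplex {
  cochain :> nat -> zmodType;
  differential : forall n, {additive cochain n -> cochain n.+1};
  differentialK : forall n x, differential n.+1 (differential n x) = 0 }.

Section Cohomology.
Variables (C : cochain_complex) (n : nat).

Definition cocycles : subgroup (C n) := kernel (differential C n).

Definition is_coboundary (m : nat) : C m -> Prop :=
  match m with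
  | 0%N => fun z => z = 0
  | k.+1 => fun z => exists y, differential C k y = z
  end.

Let coboundary0 m : is_coboundary (0 : C m).
Proof. by case: m => [|k] //; exists 0; apply: raddf0. Qed.
Let coboundaryB m (y z : C m) :
  is_coboundary y -> is_coboundary z -> is_coboundary (y - z).
Proof.
case: m y z => [|k] y z /=; first by move=> -> ->; rewrite subr0.
by move=> [a <-] [b <-]; exists (a - b); apply: raddfB.
Qed.

Definition coboundaries : subgroup (subgroup_type cocycles) :=
  @Subgroup (subgroup_type cocycles)
    (fun z => is_coboundary (subgroup_val z)) (coboundary0 n)
    (fun y z => @coboundaryB n (subgroup_val y) (subgroup_val z)).

Definition cohomology : zmodType := quotient coboundaries.

End Cohomology.

Section Functors.
Variables (disp : Order.disp_t) (P : porderType disp).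

Record functor := Functor {
  fobj :> P -> zmodType;
  fmap : forall p q : P, (p <= q)%O -> {additive fobj p -> fobj q};
  fmap_id : forall (p : P) (h : (p <= p)%O) x, fmap h x = x;
  fmap_comp : forall (p q r : P) (h1 : (p <= q)%O) (h2 : (q <= r)%O)
      (h3 : (p <= r)%O) x,
    fmap h3 x = fmap h2 (fmap h1 x) }.

Record nattrans (A B : functor) := NatTrans {
  ncomp :> forall p : P, {additive A p -> B p};
  ncomp_natural : forall (p q : P) (h : (p <= q)%O) x,
    ncomp q (fmap A h x) = fmap B h (ncomp p x) }.

Section Compose.
Variables (A B C : functor) (g : nattrans B C) (f : nattrans A B).

Let comp_comp (p : P) : {additive A p -> C p} := g p \o f p.
Let comp_natural (p q : P) (h : (p <= q)%O) x :
  comp_comp q (fmap A h x) = fmap C h (comp_comp p x).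
Proof. by rewrite /comp_comp /= !ncomp_natural. Qed.

Definition nt_comp : nattrans A C := NatTrans comp_natural.

End Compose.

Definition constant_functor (V : zmodType) : functor :=
  @Functor (fun=> V) (fun p q _ => [the {additive V -> V} of idfun])
    (fun p _ x => erefl)
    (fun p q r _ _ _ x => erefl).

Section Cokernel.
Variables (A B : functor) (f : nattrans A B).

Let obj (p : P) : zmodType := quotient (image (f p)).

Let map_image (p q : P) (h : (p <= q)%O) x :
  image (f p) x -> image (f q) (fmap B h x).
Proof. by move=> [a <-]; exists (fmap A h a); rewrite ncomp_natural. Qed.

Let map (p q : P) (h : (p <= q)%O) : {additive obj p -> obj q} :=
  quotient_map (map_image h).

Let map_id (p : P) (h : (p <= p)%O) x : map h x = x.
Proof.
by have [y <-] := to_quotient_surj x; rewrite /map quotient_mapE fmap_id.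
Qed.

Let map_comp (p q r : P) (h1 : (p <= q)%O) (h2 : (q <= r)%O) (h3 : (p <= r)%O) x :
  map h3 x = map h2 (map h1 x).
Proof.
have [y <-] := to_quotient_surj x.
by rewrite /map (quotient_mapE (map_image h1)) !quotient_mapE (fmap_comp h1 h2).
Qed.

Definition nt_coker : functor := Functor map_id map_comp.

Let pi_comp (p : P) : {additive B p -> nt_coker p} := to_quotient (image (f p)).
Let pi_natural (p q : P) (h : (p <= q)%O) x :
  pi_comp q (fmap B h x) = fmap nt_coker h (pi_comp p x).
Proof. exact: esym (quotient_mapE (map_image h) x). Qed.

Definition nt_to_coker : nattrans B nt_coker := NatTrans pi_natural.

End Cokernel.

Section Limit.
Variable A : functor.

Definition is_compatible (x : product A) : Prop :=
  forall (p q : P) (h : (p <= q)%O), fmap A h (x p) = x q.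

Let compatible0 : is_compatible 0.
Proof. by move=> p q h; rewrite !product0E raddf0. Qed.
Let compatibleB x y : is_compatible x -> is_compatible y -> is_compatible (x - y).
Proof. by move=> cx cy p q h; rewrite !productBE raddfB cx cy. Qed.

Definition compatible : subgroup (product A) := Subgroup compatible0 compatibleB.

Definition limit : zmodType := subgroup_type compatible.

Lemma limitP (x : limit) : is_compatible (subgroup_val x).
Proof. exact/(subgroup_predP compatible)/subgroup_valP. Qed.

End Limit.

Section LimitMap.
Variables (A B : functor) (f : nattrans A B).

Let map_val (x : limit A) : product B := fun p => f p (subgroup_val x p).
Let map_valP x : is_compatible (map_val x).
Proof. by move=> p q h; rewrite /map_val -ncomp_natural limitP. Qed.
Let map (x : limit A) : limit B := subgroup_elt (S := compatible B) (map_valP x).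
Let map_additive : zmod_morphism map.
Proof.
by move=> x y; apply: val_inj; apply: product_ext => p; rewrite /= /map_val raddfB.
Qed.

Definition limit_map : {additive limit A -> limit B} := additive_of map_additive.

Lemma limit_mapE x p : subgroup_val (limit_map x) p = f p (subgroup_val x p).
Proof. by []. Qed.

End LimitMap.

Definition nt_mono (A B : functor) (f : nattrans A B) : Prop :=
  forall p : P, injective (f p).

Definition injective_functor (I : functor) : Prop :=
  forall (A B : functor) (i : nattrans A B) (f : nattrans A I),
    nt_mono i -> exists g : nattrans B I, forall p x, g p (i p x) = f p x.

Record injective_resolution (A : functor) := InjectiveResolution {
  res :> nat -> functor;
  res_injective : forall n, injective_functor (res n);
  res_aug : nattrans A (res 0);
  res_diff : forall n, nattrans (res n) (res n.+1);
  res_aug_mono : nt_mono res_aug;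
  res_exact0 : forall p x,
    res_diff 0 p x = 0 <-> exists a, res_aug p a = x;
  res_exact : forall n p x,
    res_diff n.+1 p x = 0 <-> exists y, res_diff n p y = x }.

Section LimitComplex.
Variables (A : functor) (I : injective_resolution A).

Let limit_diff n : {additive limit (I n) -> limit (I n.+1)} :=
  limit_map (res_diff I n).
Let limit_diffK n x : limit_diff n.+1 (limit_diff n x) = 0.
Proof.
apply: val_inj; apply: product_ext => p; apply/(res_exact (i := I)).
by exists (subgroup_val x p).
Qed.

Definition limit_complex : cochain_complex := CochainComplex limit_diffK.

End LimitComplex.

End Functors.

Definition rat_int : subgroup rat :=
  @Subgroup rat (fun x => x \is a Num.int) (rpred0 _) (@rpredB _ _).

Definition QZ : zmodType := quotient rat_int.

Lemma QZ_divisible (n : nat) (x : QZ) : (0 < n)%N -> exists y, y *+ n = x.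
Proof.
move=> n0; have [q <-] := to_quotient_surj x.
exists (to_quotient rat_int (q / n%:R)).
by rewrite -raddfMn -(mulr_natr (q / n%:R)) divfK // pnatr_eq0 -lt0n.
Qed.

Section ExtendGraph.
Variables (Y : zmodType) (G0 : set (Y * QZ)).
Hypothesis G00 : G0 (0, 0).
Hypothesis G0B : forall y z s t, G0 (y, s) -> G0 (z, t) -> G0 (y - z, s - t).
Hypothesis G0_fun : forall t, G0 (0, t) -> t = 0.

(* partially defined homomorphisms extending G0, as graphs *)
Let good (G : set (Y * QZ)) : Prop :=
  [/\ G0 `<=` G,
      forall y z s t, G (y, s) -> G (z, t) -> G (y - z, s - t)
    & forall t, G (0, t) -> t = 0].

Let good0 G : good G -> G (0, 0).
Proof. by move=> [h _ _]; apply: h. Qed.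

Let goodN G y s : good G -> G (y, s) -> G (- y, - s).
Proof.
by move=> gG Ga; rewrite -(sub0r y) -(sub0r s); case: (gG) => _ h _; apply: h (good0 gG) Ga.
Qed.

Let goodD G y z s t : good G -> G (y, s) -> G (z, t) -> G (y + z, s + t).
Proof.
move=> gG Gy Gz; rewrite -(opprK z) -(opprK t).
by case: (gG) => _ h _; apply: h Gy (goodN gG Gz).
Qed.

Let goodM G y s n : good G -> G (y, s) -> G (y *+ n, s *+ n).
Proof.
move=> gG Gy; elim: n => [|n IH]; first by rewrite !mulr0n; apply: good0.
by rewrite !mulrS; apply: goodD.
Qed.

Let good_fun G y s t : good G -> G (y, s) -> G (y, t) -> s = t.
Proof.
move=> [_ h0 h] Gs Gt; apply/eqP; rewrite -subr_eq0; apply/eqP/h.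
by rewrite -(subrr y); apply: h0.
Qed.

Let G0_good : good G0. Proof. by split. Qed.

Let maximal_good : exists2 G, good G & forall H, good H -> G `<=` H -> H `<=` G.
Proof.
have [F FP totF|G [PG maxG]] := @Zorn_bigcup _ [set G | G = set0 \/ good G].
  have [[G FG gG]|noG] := pselect (exists2 G, F G & good G); [right|left]; last first.
    apply/seteqP; split=> // a [G FG Ga].
    case: (FP G FG) => [E|gG]; first by rewrite E in Ga.
    by apply: noG; exists G.
  have gF H a : F H -> H a -> good H.
    by move=> FH Ha; case: (FP H FH) => // E; rewrite E in Ha.
  split=> [x Gx|y z s t [H FH Ha] [K FK Kb]|t [H FH Ht]].
  - by exists G => //; case: gG => h _ _; apply: h.
  - have [HK|KH] := totF H K FH FK.
    + by exists K => //; case: (gF K _ FK Kb) => _ h _; apply: h => //; apply: HK.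
    + by exists H => //; case: (gF H _ FH Ha) => _ h _; apply: h => //; apply: KH.
  - by case: (gF H _ FH Ht) => _ _; apply.
have gG : good G.
  case: PG => // E; exfalso; apply: (maxG _ _ (or_intror G0_good)).
  by rewrite E; split=> // h; apply: (h _ G00).
exists G => // H gH GH; apply: contrapT => nHG.
by apply: (maxG H); [split | right].
Qed.

Let one_step G b : good G -> exists t, forall n s, G (b *+ n, s) -> s = t *+ n.
Proof.
move=> gG.
have [ex|nex] := pselect (exists n, (0 < n)%N && `[< exists s, G (b *+ n, s) >]).
  have [m /andP[m0 /asboolP[s0 Gs0]] min] := ex_minnP ex.
  have [t ts] := QZ_divisible s0 m0.
  exists t => n s Gs.
  have Gr : G (b *+ (n %% m), s - s0 *+ (n %/ m)).
    have -> : b *+ (n %% m) = b *+ n - (b *+ m) *+ (n %/ m).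
      by rewrite -mulrnA mulnC {2}(divn_eq n m) mulrnDr addrC addKr.
    by case: (gG) => _ h _; apply: h => //; apply: goodM.
  have r0 : (n %% m = 0)%N.
    apply/eqP; rewrite -leqn0 leqNgt; apply/negP => r0.
    have := min (n %% m)%N; rewrite r0 /= leqNgt ltn_mod m0 /= => /(_ _)/notF; apply.
    by apply/asboolP; exists (s - s0 *+ (n %/ m)).
  rewrite r0 mulr0n in Gr.
  have /eqP : s - s0 *+ (n %/ m) = 0 by case: gG => _ _; apply.
  by rewrite subr_eq0 => /eqP ->; rewrite -ts -mulrnA mulnC {2}(divn_eq n m) r0 addn0.
exists 0 => n s; case: n => [|n Gs].
  by rewrite !mulr0n; case: gG => _ _; apply.
by exfalso; apply: nex; exists n.+1; apply/asboolP; exists s.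
Qed.

Let extend G b : good G -> exists2 H, good H & G `<=` H /\ exists t, H (b, t).
Proof.
move=> gG; have [t tP] := one_step b gG.
pose H : set (Y * QZ) := [set yt |
  exists n k s z, [/\ G (z, s), yt.1 = z + (b *+ n - b *+ k) & yt.2 = s + (t *+ n - t *+ k)]].
exists H; last split.
- split=> [[y s] Gy|y1 y2 s1 s2|u].
  + exists 0%N, 0%N, s, y => /=; rewrite !mulr0n !subr0 !addr0; split=> //.
    by case: gG => h _ _; apply: h.
  + move=> [n [k [s [z [Gz /= -> ->]]]]] [n' [k' [s' [z' [Gz' /= -> ->]]]]].
    exists (n + k')%N, (k + n')%N, (s - s'), (z - z').
    split; first by case: gG => _ h _; apply: h.
    * rewrite /= opprD addrACA !mulrnDr; congr (_ + _).
      by rewrite [in RHS]opprD -addrACA opprB.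
    * rewrite /= opprD addrACA !mulrnDr; congr (_ + _).
      by rewrite [in RHS]opprD -addrACA opprB.
  + move=> [n [k [s [z [Gz /= /esym E ->]]]]].
    have [kn|nk] := leqP k n.
      have E' : - z = b *+ (n - k).
        by rewrite mulrnBr // (addr0_eq E).
      have := goodN gG Gz; rewrite E' => /tP; rewrite mulrnBr // => <-.
      by rewrite subrr.
    have E' : z = b *+ (k - n).
      by rewrite mulrnBr 1?ltnW // -[LHS]opprK (addr0_eq E) opprB.
    move: Gz; rewrite E' => /tP ->; rewrite mulrnBr 1?ltnW //.
    by rewrite addrA subrK subrr.
- move=> [y s] Gy; exists 0%N, 0%N, s, y => /=.
  by rewrite !mulr0n !subr0 !addr0.
- exists t; exists 1%N, 0%N, 0, 0 => /=.
  by rewrite !mulr1n !mulr0n !subr0 !add0r; split=> //; apply: good0.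
Qed.

Lemma QZ_extend_graph :
  exists g : {additive Y -> QZ}, forall y s, G0 (y, s) -> g y = s.
Proof.
have [G gG maxG] := maximal_good.
have /choice[g gP] y : exists t, G (y, t).
  have [H gH [GH [t Ht]]] := extend y gG.
  by exists t; apply: maxG Ht.
have gB : zmod_morphism g.
  by move=> y z; apply: (good_fun gG (gP _)); case: (gG) => _ h _; apply: h.
exists (additive_of gB) => y s Gy; apply: (good_fun gG (gP _)).
by case: gG => h _ _; apply: h.
Qed.

End ExtendGraph.

Lemma QZ_extension (X Y : zmodType) (i : {additive X -> Y}) (f : {additive X -> QZ}) :
  injective i -> exists g : {additive Y -> QZ}, forall x, g (i x) = f x.
Proof.
move=> i_inj.
have [|y z s t [x [/= -> ->]] [x' [/= -> ->]]|t [x [/= ix ->]]|g gP] :=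
    @QZ_extend_graph Y [set yt | exists x, yt.1 = i x /\ yt.2 = f x].
- by exists 0; rewrite /= !raddf0.
- by exists (x - x'); rewrite /= !raddfB.
- by rewrite (_ : x = 0) ?raddf0 //; apply: i_inj; rewrite -ix raddf0.
- by exists g => x; apply: gP; exists x.
Qed.

Lemma QZ_separates (X : zmodType) (a : X) :
  (forall chi : {additive X -> QZ}, chi a = 0) -> a = 0.
Proof.
move=> chi0; apply: contrapT => a0.
have frac_neq0 m : (1 < m)%N -> to_quotient rat_int m%:R^-1 <> 0.
  move=> m1 /to_quotient_eq0 /= /intrP[k mk].
  have : (0 < k%:~R :> rat) && (k%:~R < 1 :> rat).
    by rewrite -mk invr_gt0 invf_lt1 ltr0n ?ltr1n 1?ltnW.
  by rewrite ltr0z ltrz1; case: k {mk} => [[|k]|k].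
have [t t0 tP] : exists2 t : QZ, t <> 0 & forall n, a *+ n = 0 -> t *+ n = 0.
  have [ex|nex] := pselect (exists n, (0 < n)%N && (a *+ n == 0)); last first.
    exists (to_quotient rat_int 2%:R^-1) => [|[|n] an]; first exact: frac_neq0.
      by rewrite mulr0n.
    by exfalso; apply: nex; exists n.+1; apply/eqP.
  have [m /andP[m0 /eqP am] min] := ex_minnP ex.
  have m1 : (1 < m)%N.
    by case: m m0 am {min} => [|[|m]] // _; rewrite mulr1n.
  exists (to_quotient rat_int m%:R^-1) => [|n an]; first exact: frac_neq0.
  have r0 : (n %% m = 0)%N.
    apply/eqP; rewrite -leqn0 leqNgt; apply/negP => r0.
    have := min (n %% m)%N; rewrite r0 /= leqNgt ltn_mod m0 /= => /(_ _)/notF; apply.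
    move: an; rewrite {1}(divn_eq n m) mulrnDr mulnC mulrnA am mul0rn add0r.
    by move=> ->.
  have tm : to_quotient rat_int m%:R^-1 *+ m = 0.
    rewrite -raddfMn -(mulr_natr m%:R^-1) mulVf ?pnatr_eq0 -?lt0n //.
    by apply/to_quotient_eq0; rewrite /= rpred1.
  by rewrite (divn_eq n m) r0 addn0 mulnC mulrnA tm mul0rn.
have [|y z s u|u|g gP] := @QZ_extend_graph X
    [set yt | exists n k, yt.1 = a *+ n - a *+ k /\ yt.2 = t *+ n - t *+ k].
- by exists 0%N, 0%N; rewrite !mulr0n !subr0.
- move=> [n [k [/= -> ->]]] [n' [k' [/= -> ->]]].
  by exists (n + k')%N, (k + n')%N => /=; split;
    rewrite !mulrnDr [in RHS]opprD -addrACA opprB.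
- move=> [n [k [/= /esym E ->]]].
  have [kn|nk] := leqP k n.
    by rewrite -mulrnBr //; apply: tP; rewrite mulrnBr.
  have /tP : a *+ (k - n) = 0 by rewrite mulrnBr 1?ltnW // -opprB E oppr0.
  by rewrite mulrnBr 1?ltnW // => /eqP; rewrite subr_eq0 => /eqP ->; rewrite subrr.
apply: t0; rewrite -(chi0 g); apply/esym/gP; exists 1%N, 0%N.
by rewrite !mulr0n !subr0.
Qed.

Section Hull.
Variables (disp : Order.disp_t) (P : porderType disp).

Section HullFunctor.
Variable A : functor P.

Record hull_index (p : P) := HullIndex {
  hull_point : P;
  hull_le : (p <= hull_point)%O;
  hull_char : {additive A hull_point -> QZ} }.

Let obj (p : P) : zmodType := product (fun _ : hull_index p => QZ).

Let push (p q : P) (h : (p <= q)%O) (i : hull_index q) : hull_index p :=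
  HullIndex (le_trans h (hull_le i)) (hull_char i).

Let map_fun (p q : P) (h : (p <= q)%O) (x : obj p) : obj q :=
  fun i => x (push h i).

Let map_additive (p q : P) (h : (p <= q)%O) : zmod_morphism (map_fun h).
Proof. by []. Qed.

Let map (p q : P) (h : (p <= q)%O) : {additive obj p -> obj q} :=
  additive_of (map_additive h).

Let map_id (p : P) (h : (p <= p)%O) x : map h x = x.
Proof.
apply: product_ext => -[q le chi]; congr (x _).
by rewrite /push /=; congr HullIndex; apply: bool_irrelevance.
Qed.

Let map_comp (p q r : P) (h1 : (p <= q)%O) (h2 : (q <= r)%O) (h3 : (p <= r)%O) x :
  map h3 x = map h2 (map h1 x).
Proof.
apply: product_ext => -[s le chi]; congr (x _).
by rewrite /push /=; congr HullIndex; apply: bool_irrelevance.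
Qed.

Definition hull : functor P := Functor map_id map_comp.

Lemma hull_mapE (p q : P) (h : (p <= q)%O) (x : hull p) (i : hull_index q) :
  (fmap hull h x : obj q) i = (x : obj p) (push h i).
Proof. by []. Qed.

Let unit_fun (p : P) (a : A p) : hull p :=
  (fun i => hull_char i (fmap A (hull_le i) a)) : obj p.

Let unit_additive (p : P) : zmod_morphism (@unit_fun p).
Proof. by move=> a b; apply: product_ext => i; rewrite /unit_fun !raddfB. Qed.

Let unit_natural (p q : P) (h : (p <= q)%O) x :
  additive_of (@unit_additive q) (fmap A h x) =
  fmap hull h (additive_of (@unit_additive p) x).
Proof.
apply: product_ext => i; rewrite hull_mapE /= /unit_fun /=.
by congr (hull_char i _); apply/esym/fmap_comp.
Qed.

Definition hull_unit : nattrans A hull := NatTrans unit_natural.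

Lemma hull_unit_mono : nt_mono hull_unit.
Proof.
move=> p a b ab; apply/eqP; rewrite -subr_eq0; apply/eqP/QZ_separates => chi.
have := congr1 (fun x : obj p => x (HullIndex (lexx p) chi)) ab.
by rewrite /= /unit_fun /= !fmap_id raddfB => ->; rewrite subrr.
Qed.

Lemma hull_injective : injective_functor hull.
Proof.
move=> B C i f i_mono.
pose at_ (q : P) chi (b : B q) := (f q b : obj q) (HullIndex (lexx q) chi).
have at_additive q chi : zmod_morphism (@at_ q chi).
  by move=> b c; rewrite /at_ raddfB.
pose ext q chi := cid (QZ_extension (additive_of (at_additive q chi)) (i_mono q)).
pose g p (c : C p) : hull p :=
  (fun j => sval (ext _ (hull_char j)) (fmap C (hull_le j) c)) : obj p.
have g_additive p : zmod_morphism (g p).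
  by move=> b c; apply: product_ext => j; rewrite /g !raddfB.
have g_natural (p q : P) (h : (p <= q)%O) x :
    additive_of (g_additive q) (fmap C h x) =
    fmap hull h (additive_of (g_additive p) x).
  apply: product_ext => j; rewrite hull_mapE /= /g /=.
  by apply: (congr1 (sval (ext _ (hull_char j)))); apply/esym/fmap_comp.
exists (NatTrans g_natural) => p b; apply: product_ext => -[q le chi].
rewrite /= /g /= -ncomp_natural (svalP (ext q chi)) /= /at_ ncomp_natural hull_mapE.
by congr (f p b _); rewrite /push /=; congr HullIndex; apply: bool_irrelevance.
Qed.

End HullFunctor.

Section Resolution.
Variable A : functor P.

Fixpoint syzygy (n : nat) : functor P :=
  if n is k.+1 then nt_coker (hull_unit (syzygy k)) else A.

Let I n := hull (syzygy n).
Let d n : nattrans (I n) (I n.+1) :=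
  nt_comp (hull_unit (syzygy n.+1)) (nt_to_coker (hull_unit (syzygy n))).

Let pi n p : {additive I n p -> syzygy n.+1 p} :=
  to_quotient (image (hull_unit (syzygy n) p)).
Let dE n p x : d n p x = hull_unit (syzygy n.+1) p (pi n p x). Proof. by []. Qed.

Let d_ker n p x : d n p x = 0 <-> exists a, hull_unit (syzygy n) p a = x.
Proof.
rewrite dE; split=> [dx0|[a ax]].
  apply/(to_quotient_eq0 (image (hull_unit (syzygy n) p))).
  by apply: (@hull_unit_mono (syzygy n.+1) p); rewrite raddf0.
have -> : pi n p x = 0 by apply/to_quotient_eq0; exists a.
exact: raddf0.
Qed.

Let d_exact n p x : d n.+1 p x = 0 <-> exists y, d n p y = x.
Proof.
rewrite d_ker; split=> -[a <-]; last by exists (pi n p a).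
by have [y <-] := to_quotient_surj a; exists y.
Qed.

Definition canonical_resolution : injective_resolution A :=
  @InjectiveResolution _ _ A I (fun n => @hull_injective _)
    (hull_unit A) d (@hull_unit_mono A) (@d_ker 0) d_exact.

End Resolution.
End Hull.

(* The right derived functors of the inverse limit: cohomology of the limit of
   an injective resolution.  Up to isomorphism the resolution is irrelevant. *)
Definition higher_limit (disp : Order.disp_t) (P : porderType disp)
    (A : functor P) (n : nat) : zmodType :=
  cohomology (limit_complex (canonical_resolution A)) n.

Definition poset_cohomology (disp : Order.disp_t) (P : porderType disp)
    (n : nat) : zmodType :=
  higher_limit (constant_functor P int) n.

Section GradedPoset.
Variables (disp : Order.disp_t) (P : porderType disp).

Definition precedes (p q : P) : Prop :=
  (p < q)%O /\
  forall r : P, (p <= r)%O -> (r <= q)%O -> r = p \/ r = q.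

Record graded (deg : P -> nat) : Prop := Graded {
  graded_anti : forall p q : P, (p <= q)%O -> (deg q <= deg p)%N;
  graded_precedes : forall p q : P, precedes p q -> deg p = (deg q).+1;
  graded_finite : forall p0 : P, finite_set [set p : P | (p0 <= p)%O] }.

(* Nonempty, and any two elements of S are joined by a zigzag inside S. *)
Definition connected_subposet (S : set P) : Prop :=
  S !=set0 /\
  forall p q, S p -> S q ->
    clos_refl_sym_trans P (fun x y => [/\ S x, S y & (x <= y)%O]) p q.

Variable deg : P -> nat.

Definition above_strict (p0 : P) : set P := [set p | (p0 < p)%O].

Definition above_deg (p0 : P) (n : nat) : set P :=
  [set p | (p0 <= p)%O /\ deg p = n].

(* J p0 n is only meaningful for n <= deg p0, and is unconstrained otherwise. *)
Record local_covering_family (J : P -> nat -> set P) : Prop := LocalCovering {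
  covering_sub : forall (p0 : P) n,
    (n <= deg p0)%N -> J p0 n `<=` above_deg p0 n;
  covering_cover : forall (p0 : P) n, (n < deg p0)%N ->
    \bigcup_(p in J p0 n.+1) above_deg p n = above_deg p0 n;
  covering_trans : forall (p0 : P) n, (n < deg p0)%N ->
    forall p, J p0 n.+1 p -> J p n `<=` J p0 n }.

(* The number R_n^{p0}; only meaningful for n <= deg p0. *)
Fixpoint Rnum (n : nat) (p0 : P) : int :=
  if n is k.+1 then \sum_(p \in above_deg p0 k) Rnum k p - Rnum k p0 else 1.

Record adequate (J : P -> nat -> set P) : Prop := Adequate {
  adequate_connected : forall p0 : P,
    (2 <= deg p0)%N -> connected_subposet (above_strict p0);
  adequate_rank : forall n (p0 : P), (n.+1 <= deg p0)%N ->
    Rnum n p0 = \sum_(p \in J p0 n) Rnum n p }.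

Section AboveProduct.
Variables (A : functor P) (n : nat).

Let index (p0 : P) : Type := {p : P | (p0 <= p)%O && (deg p == n)}.

Definition above_product_obj (p0 : P) : zmodType :=
  product (fun i : index p0 => A (val i)).

Lemma above_indexP (p0 q0 : P) (h : (p0 <= q0)%O) (i : index q0) :
  (p0 <= val i)%O && (deg (val i) == n).
Proof. by have /andP[le ->] := valP i; rewrite (le_trans h le). Qed.

Let project_fun (p0 q0 : P) (h : (p0 <= q0)%O) (x : above_product_obj p0) :
    above_product_obj q0 :=
  fun i => x (exist _ (val i) (above_indexP h i)).

Let project_additive (p0 q0 : P) (h : (p0 <= q0)%O) : zmod_morphism (project_fun h).
Proof. by []. Qed.

Let project (p0 q0 : P) (h : (p0 <= q0)%O) :
  {additive above_product_obj p0 -> above_product_obj q0} :=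
  additive_of (project_additive h).

Let index_irrelevance (p0 q : P) (x : above_product_obj p0)
    (h h' : (p0 <= q)%O && (deg q == n)) :
  x (exist _ q h) = x (exist _ q h') :> A q.
Proof. by rewrite (bool_irrelevance h h'). Qed.

Let project_id (p : P) (h : (p <= p)%O) x : project h x = x.
Proof. by apply: product_ext => -[q hq]; exact: (index_irrelevance x). Qed.

Let project_comp (p q r : P) (h1 : (p <= q)%O) (h2 : (q <= r)%O) (h3 : (p <= r)%O) x :
  project h3 x = project h2 (project h1 x).
Proof. by apply: product_ext => -[s hs]; exact: (index_irrelevance x). Qed.

(* p0 |-> the product of the A p over the p >= p0 of degree n *)
Definition above_product : functor P := Functor project_id project_comp.

Let above_index_le (p0 : P) (i : index p0) : (p0 <= val i)%O.
Proof. by have /andP[] := valP i. Qed.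

Let diag_fun (p0 : P) (a : A p0) : above_product p0 :=
  (fun i => fmap A (above_index_le i) a) : above_product_obj p0.

Let diag_additive (p0 : P) : zmod_morphism (@diag_fun p0).
Proof. by move=> a b; apply: product_ext => i; apply: raddfB. Qed.

Let diag_natural (p q : P) (h : (p <= q)%O) x :
  additive_of (@diag_additive q) (fmap A h x) =
  fmap above_product h (additive_of (@diag_additive p) x).
Proof.
apply: product_ext => i /=; rewrite /diag_fun /project_fun /=.
exact/esym/fmap_comp.
Qed.

Definition above_diagonal : nattrans A above_product := NatTrans diag_natural.

End AboveProduct.

Fixpoint Fseq (n : nat) : functor P :=
  if n is k.+1 then nt_coker (above_diagonal (Fseq k) k)
  else constant_functor P int.

Definition Fproduct (n : nat) : zmodType :=
  product (fun p : {p : P | deg p == n} => Fseq n (val p)).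

End GradedPoset.

(* Main.v *)
Require Import Defs.
From mathcomp Require Import all_boot all_order all_algebra.
From mathcomp Require Import boolp classical_sets cardinality fsbigop.

(* The sequences 0 -> F_n -> F'_n -> F_{n+1} -> 0, with F'_n p0 the product of the
   F_n p over the p >= p0 of degree n, splice into a resolution of the constant
   functor Z. Each F'_n is a retract of a Godement functor p |-> prod_(q >= p) A q,
   hence acyclic for the inverse limit, and lim F'_n is the product of the F_n p
   over the p of degree n. An acyclic resolution computes the higher limits by
   dimension shifting.

   Only exactness on the left needs the covering family: for deg p0 > n the map
   F_n p0 -> prod_(p in J^{p0}_n) F_n p is bijective, by induction on n.
   Injectivity follows from the covering axioms, since a class of F_{n+1} p0 has a
   representative vanishing on J^{p0}_n. Surjectivity is a count: the equality of
   ranks forces each q with R^q_n <> 0 to lie above exactly one p in J^{p0}_{n+1}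
   outside J^p_n, so that normalized representatives over the various p agree on
   overlaps; and F_n q = 0 when R^q_n = 0. *)

Import Order.TTheory GRing.Theory Num.Theory.
Local Open Scope ring_scope.

Set Implicit Arguments.
Unset Strict Implicit.
Unset Printing Implicit Defensive.

Lemma dependent_choice (T : Type) (U : T -> Type) (R : forall t, U t -> Prop) :
  (forall t, exists u, R t u) -> exists f : forall t, U t, forall t, R t (f t).
Proof. by move=> h; exists (fun t => sval (cid (h t))) => t; case: cid. Qed.

Lemma zmod_isom_sym (U V : zmodType) : zmod_isom U V -> zmod_isom V U.
Proof.
move=> [f [g fK gK]].
by exists (additive_of (can2_zmod_morphism fK gK)); exists f.
Qed.

Lemma zmod_isom_trans (U V W : zmodType) :
  zmod_isom U V -> zmod_isom V W -> zmod_isom U W.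
Proof.
by move=> [f fbij] [g gbij]; exists (g \o f : {additive U -> W}); apply: bij_comp.
Qed.

Section QuotientRelation.
Variables (U V : zmodType) (S : subgroup U) (T : subgroup V) (R : U -> V -> Prop).
Hypothesis RB : forall u v u' v', R u v -> R u' v' -> R (u - u') (v - v').
Hypothesis R_total : forall u, exists v, R u v.
Hypothesis R_compat : forall u v, R u v -> S u -> T v.

Lemma quotient_relation_map : exists f : {additive quotient S -> quotient T},
  forall u v, R u v -> f (to_quotient S u) = to_quotient T v.
Proof.
have [r rP] := choice R_total.
pose f (x : quotient S) : quotient T := to_quotient T (r (repr x)).
have fE u v : R u v -> f (to_quotient S u) = to_quotient T v.
  move=> Ruv; apply/eqP; rewrite -subr_eq0 -raddfB; apply/eqP/to_quotient_eq0.
  apply: (R_compat (RB (rP _) Ruv)); apply/to_quotient_eq0.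
  by rewrite raddfB /to_quotient /= reprK subrr.
have f_additive : zmod_morphism f.
  move=> x y; have [u <-] := to_quotient_surj x; have [u' <-] := to_quotient_surj y.
  by rewrite -raddfB (fE _ _ (RB (rP u) (rP u'))) !(fE _ _ (rP _)) raddfB.
by exists (additive_of f_additive).
Qed.

End QuotientRelation.

Lemma quotient_isom (U V : zmodType) (S : subgroup U) (T : subgroup V)
    (R : U -> V -> Prop) :
    (forall u v u' v', R u v -> R u' v' -> R (u - u') (v - v')) ->
    (forall u, exists v, R u v) -> (forall v, exists u, R u v) ->
    (forall u v, R u v -> (S u <-> T v)) ->
  zmod_isom (quotient S) (quotient T).
Proof.
move=> RB Rl Rr RST.
have [|f fE] := @quotient_relation_map U V S T R RB Rl.
  by move=> u v /RST[].
have [|||g gE] := @quotient_relation_map V U T S (fun v u => R u v).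
- by move=> v u v' u' *; apply: RB.
- exact: Rr.
- by move=> v u /RST[].
exists f; exists g => x.
  have [u <-] := to_quotient_surj x; have [v Ruv] := Rl u.
  by rewrite (fE _ _ Ruv) (gE _ _ Ruv).
have [v <-] := to_quotient_surj x; have [u Ruv] := Rr v.
by rewrite (gE _ _ Ruv) (fE _ _ Ruv).
Qed.

Section AboveProduct.
Variables (disp : Order.disp_t) (P : porderType disp) (deg : P -> nat) (n : nat).

Definition acoord (A : functor P) (p q : P) (h : (p <= q)%O && (deg q == n))
  (x : above_product deg A n p) : A q := (x : above_product_obj deg A n p) (exist _ q h).

Definition of_acoord (A : functor P) (p : P)
    (z : forall q, (p <= q)%O && (deg q == n) -> A q) : above_product deg A n p :=
  (fun i => z (val i) (valP i)) : above_product_obj deg A n p.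

Lemma of_acoordK A p z q h : acoord h (@of_acoord A p z) = z q h.
Proof. by rewrite /acoord /of_acoord /=; congr (z _ _); apply: bool_irrelevance. Qed.

Lemma acoord_ext (A : functor P) p (x y : above_product deg A n p) :
  (forall q (h : (p <= q)%O && (deg q == n)), acoord h x = acoord h y) -> x = y.
Proof. by move=> xy; apply: product_ext => -[q h]; apply: xy. Qed.

Lemma acoord_irr (A : functor P) p q (h h' : (p <= q)%O && (deg q == n))
  (x : above_product deg A n p) : acoord h x = acoord h' x.
Proof. by rewrite (bool_irrelevance h h'). Qed.

Lemma acoordB (A : functor P) p q (h : (p <= q)%O && (deg q == n)) :
  {morph @acoord A p q h : x y / x - y}.
Proof. by []. Qed.

Lemma acoord_map (A : functor P) p p' (hp : (p <= p')%O) q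
    (h : (p' <= q)%O && (deg q == n)) (h' : (p <= q)%O && (deg q == n))
    (x : above_product deg A n p) :
  acoord h (fmap (above_product deg A n) hp x) = acoord h' x.
Proof. by rewrite (bool_irrelevance h' (above_indexP hp (exist _ q h))). Qed.

Lemma acoord_diagonal (A : functor P) p q (h : (p <= q)%O && (deg q == n))
    (hp : (p <= q)%O) (a : A p) :
  acoord h (above_diagonal deg A n p a) = fmap A hp a.
Proof. by rewrite /acoord /=; congr (fmap A _ a); apply: bool_irrelevance. Qed.

Section Map.
Variables (A B : functor P) (f : nattrans A B).

Let map_fun p (x : above_product deg A n p) : above_product deg B n p :=
  of_acoord (fun q h => f q (acoord h x)).

Let map_additive p : zmod_morphism (@map_fun p).
Proof. by move=> x y; apply: product_ext => i; apply: raddfB. Qed.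

Let map_natural p p' (hp : (p <= p')%O) x :
  additive_of (@map_additive p') (fmap (above_product deg A n) hp x) =
  fmap (above_product deg B n) hp (additive_of (@map_additive p) x).
Proof.
apply: acoord_ext => q h; have h' : (p <= q)%O && (deg q == n).
  by move: h => /andP[pq ->]; rewrite (le_trans hp pq).
by rewrite (acoord_map _ h h') !additive_ofE !of_acoordK (acoord_map _ h h').
Qed.

Definition above_product_map : nattrans (above_product deg A n) (above_product deg B n) :=
  NatTrans map_natural.

Lemma acoord_above_product_map p q (h : (p <= q)%O && (deg q == n)) x :
  acoord h (above_product_map p x) = f q (acoord h x).
Proof. by rewrite of_acoordK. Qed.

End Map.

Variable A : functor P.

Lemma limit_coord (x : limit (above_product deg A n)) p q
    (h : (p <= q)%O && (deg q == n)) (h' : (q <= q)%O && (deg q == n)) :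
  acoord h (subgroup_val x p) = acoord h' (subgroup_val x q).
Proof.
by have /andP[pq _] := h; rewrite -(limitP x pq) (acoord_map _ h' h).
Qed.

Definition limit_section (y : forall q, deg q == n -> A q) :
  forall p, above_product deg A n p := fun p => of_acoord (fun q h => y q (andP h).2).

Lemma limit_section_compatible y : is_compatible (@limit_section y).
Proof.
move=> p p' hp; apply: acoord_ext => q h.
have h' : (p <= q)%O && (deg q == n).
  by move: h => /andP[pq ->]; rewrite (le_trans hp pq).
by rewrite (acoord_map _ h h') !of_acoordK; congr y; apply: bool_irrelevance.
Qed.

Let to_degree (x : limit (above_product deg A n)) :
  product (fun i : {p : P | deg p == n} => A (val i)) :=
  fun i => acoord (introT andP (conj (lexx (val i)) (valP i))) (subgroup_val x (val i)).

Let to_degree_additive : zmod_morphism to_degree.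
Proof. by move=> x y. Qed.

Lemma limit_above_product : exists f : {additive limit (above_product deg A n) ->
  product (fun i : {p : P | deg p == n} => A (val i))}, bijective f.
Proof.
exists (additive_of to_degree_additive).
pose g (y : product (fun i : {p : P | deg p == n} => A (val i))) :
    limit (above_product deg A n) :=
  subgroup_elt (S := compatible (above_product deg A n))
    (limit_section_compatible (fun q h => y (exist _ q h))).
exists g => [x|y].
  apply: val_inj; apply: product_ext => p; apply: acoord_ext => q h.
  by rewrite /= /limit_section of_acoordK /=; apply/esym/limit_coord.
apply: product_ext => -[q h]; apply: etrans (of_acoordK _ _) _.
by rewrite (bool_irrelevance (andP _).2 h).
Qed.

End AboveProduct.

Section Godement.
Variables (disp : Order.disp_t) (P : porderType disp).
Implicit Types A B C : functor P.

Lemma limit_ext A (x y : limit A) :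
  (forall p, subgroup_val x p = subgroup_val y p) -> x = y.
Proof. by move=> xy; apply: val_inj; apply: product_ext. Qed.

(* With a constant degree function every q >= p has the prescribed degree, so this
   is p |-> the product of the A q over all q >= p. *)
Definition godement A : functor P := above_product (fun=> 0%N) A 0.

Definition godement_unit A : nattrans A (godement A) := above_diagonal (fun=> 0%N) A 0.

Definition godement_coker A : functor P := nt_coker (godement_unit A).

Definition godement_pi A : nattrans (godement A) (godement_coker A) :=
  nt_to_coker (godement_unit A).

Lemma godement_piP A p (x : godement A p) :
  godement_pi A p x = 0 <-> exists a, godement_unit A p a = x.
Proof. exact: to_quotient_eq0. Qed.

Lemma godement_pi_surj A p (y : godement_coker A p) :
  exists x, godement_pi A p x = y.
Proof. exact: to_quotient_surj. Qed.

Definition coord_at A (p q : P) (h : (p <= q)%O) (x : godement A p) : A q :=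
  acoord (deg := fun=> 0%N) (introT andP (conj h (eqxx 0%N))) x.

Lemma coord_atB A p q (h : (p <= q)%O) : {morph @coord_at A p q h : x y / x - y}.
Proof. by []. Qed.

Lemma coord_at_ext A p (x y : godement A p) :
  (forall q (h : (p <= q)%O), coord_at h x = coord_at h y) -> x = y.
Proof.
move=> xy; apply: acoord_ext => q h; have /andP[pq _] := h.
by have := xy q pq; rewrite /coord_at !(acoord_irr _ h).
Qed.

Definition of_coord_at A p (z : forall q, (p <= q)%O -> A q) : godement A p :=
  of_acoord (deg := fun=> 0%N) (fun q h => z q (andP h).1).

Lemma of_coord_atK A p z q h : coord_at h (@of_coord_at A p z) = z q h.
Proof. by rewrite /coord_at of_acoordK; congr (z _ _); apply: bool_irrelevance. Qed.

Lemma coord_at_map A p p' (hp : (p <= p')%O) q (h : (p' <= q)%O) (h' : (p <= q)%O) x :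
  coord_at h (fmap (godement A) hp x) = coord_at h' x.
Proof. exact: acoord_map. Qed.

Lemma coord_at_unit A p q (h : (p <= q)%O) (a : A p) :
  coord_at h (godement_unit A p a) = fmap A h a.
Proof. exact: acoord_diagonal. Qed.

Definition godement_map A B (f : nattrans A B) : nattrans (godement A) (godement B) :=
  above_product_map (fun=> 0%N) 0 f.

Lemma coord_at_godement_map A B (f : nattrans A B) p q (h : (p <= q)%O) x :
  coord_at h (godement_map f p x) = f q (coord_at h x).
Proof. exact: acoord_above_product_map. Qed.

Lemma godement_map_unit A B (f : nattrans A B) p a :
  godement_map f p (godement_unit A p a) = godement_unit B p (f p a).
Proof.
by apply: coord_at_ext => q h; rewrite coord_at_godement_map !coord_at_unit ncomp_natural.
Qed.

Lemma limit_godement A (y : product A) : exists x : limit (godement A),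
  forall p q (h : (p <= q)%O), coord_at h (subgroup_val x p) = y q.
Proof.
exists (subgroup_elt (S := compatible (godement A))
  (@limit_section_compatible _ _ (fun=> 0%N) 0 A (fun q _ => y q))) => p q h.
exact: (@of_acoordK _ _ (fun=> 0%N) 0).
Qed.

Lemma limit_godementP A (x : limit (godement A)) : exists y : product A,
  forall p q (h : (p <= q)%O), coord_at h (subgroup_val x p) = y q.
Proof.
exists (fun q => coord_at (lexx q) (subgroup_val x q)) => p q h.
exact: limit_coord.
Qed.

Section CokerMap.
Variables (A B : functor P) (f : nattrans A B).

Let map_image p x : Defs.image (godement_unit A p) x ->
  Defs.image (godement_unit B p) (godement_map f p x).
Proof. by move=> [a <-]; exists (f p a); rewrite godement_map_unit. Qed.

Let map_comp p : {additive godement_coker A p -> godement_coker B p} :=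
  quotient_map (@map_image p).

Let map_compE p x : map_comp p (godement_pi A p x) = godement_pi B p (godement_map f p x).
Proof. exact: quotient_mapE. Qed.

Let map_natural p q (h : (p <= q)%O) x :
  map_comp q (fmap (godement_coker A) h x) = fmap (godement_coker B) h (map_comp p x).
Proof.
have [y <-] := godement_pi_surj x.
by rewrite -ncomp_natural !map_compE !ncomp_natural.
Qed.

Definition godement_coker_map : nattrans (godement_coker A) (godement_coker B) :=
  NatTrans map_natural.

Lemma godement_coker_mapE p x :
  godement_coker_map p (godement_pi A p x) = godement_pi B p (godement_map f p x).
Proof. exact: quotient_mapE. Qed.

End CokerMap.

Record short_exact A B C (i : nattrans A B) (g : nattrans B C) : Prop := ShortExact {
  short_exact_mono : nt_mono i;
  short_exact_mid : forall p b, g p b = 0 <-> exists a, i p a = b;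
  short_exact_epi : forall p c, exists b, g p b = c }.

Lemma nt_coker_short_exact A B (i : nattrans A B) :
  nt_mono i -> short_exact i (nt_to_coker i).
Proof.
move=> i_mono; split=> // p; first exact: to_quotient_eq0.
exact: to_quotient_surj.
Qed.

Lemma godement_unit_mono A : nt_mono (godement_unit A).
Proof.
move=> p a a' /(congr1 (coord_at (lexx p))).
by rewrite !coord_at_unit !fmap_id.
Qed.

Lemma godement_map_epi A B (f : nattrans A B) :
  (forall p b, exists a, f p a = b) -> forall p y, exists x, godement_map f p x = y.
Proof.
move=> f_epi p y; pose z q (h : (p <= q)%O) := cid (f_epi q (coord_at h y)).
exists (of_coord_at (fun q h => sval (z q h))); apply: coord_at_ext => q h.
by rewrite coord_at_godement_map of_coord_atK (svalP (z q h)).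
Qed.

Lemma godement_map_mid A B C (i : nattrans A B) (g : nattrans B C) p y :
  short_exact i g -> godement_map g p y = 0 -> exists x, godement_map i p x = y.
Proof.
move=> ig gy; have ex q (h : (p <= q)%O) : exists a, i q a = coord_at h y.
  by apply/(short_exact_mid ig); rewrite -coord_at_godement_map gy.
exists (of_coord_at (fun q h => sval (cid (ex q h)))); apply: coord_at_ext => q h.
by rewrite coord_at_godement_map of_coord_atK; case: cid.
Qed.

Lemma godement_coker_short_exact A B C (i : nattrans A B) (g : nattrans B C) :
  short_exact i g -> short_exact (godement_coker_map i) (godement_coker_map g).
Proof.
move=> ig; split=> p.
- move=> x y xy; apply/eqP; rewrite -subr_eq0; apply/eqP.
  have : godement_coker_map i p (x - y) = 0 by rewrite raddfB xy subrr.
  have [u <-] := godement_pi_surj (x - y); rewrite godement_coker_mapE.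
  move=> /godement_piP[b ub]; apply/godement_piP.
  exists (coord_at (lexx p) u); apply: coord_at_ext => q h; apply: (short_exact_mono ig).
  rewrite coord_at_unit ncomp_natural -!coord_at_godement_map -ub.
  by rewrite !coord_at_unit fmap_id.
- move=> y; have [u <-] := godement_pi_surj y; rewrite godement_coker_mapE; split.
    move=> /godement_piP[c cu]; have [b bc] := short_exact_epi ig c.
    have [|v vu] := @godement_map_mid A B C i g p (u - godement_unit B p b) ig.
      by rewrite raddfB godement_map_unit bc cu subrr.
    exists (godement_pi A p v); rewrite godement_coker_mapE vu raddfB.
    suff -> : godement_pi B p (godement_unit B p b) = 0 by rewrite subr0.
    by apply/godement_piP; exists b.
  move=> [x]; have [v <-] := godement_pi_surj x; rewrite godement_coker_mapE => vu.
  rewrite -godement_coker_mapE -vu godement_coker_mapE.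
  rewrite (_ : godement_map g p _ = 0) ?raddf0 //.
  apply: coord_at_ext => q h; rewrite !coord_at_godement_map.
  by apply/(short_exact_mid ig); exists (coord_at h v).
- move=> z; have [w <-] := godement_pi_surj z.
  have [v <-] := godement_map_epi (short_exact_epi ig) w.
  by exists (godement_pi B p v); rewrite godement_coker_mapE.
Qed.

(* The derived functor lim^1, computed by 0 -> A -> godement A -> godement_coker A -> 0. *)
Definition lim1 A : zmodType := quotient (Defs.image (limit_map (godement_pi A))).

Definition limit_epi A B (f : nattrans A B) : Prop :=
  forall y : limit B, exists x, limit_map f x = y.

Section Connecting.
Variables (A B C : functor P) (i : nattrans A B) (g : nattrans B C).
Hypotheses (ig : short_exact i g) (B_acyclic : limit_epi (godement_pi B)).

(* c and w are related when w is, up to the global family v, the connecting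
   homomorphism at c: the cocycle measuring the incompatibility of a lift b of c. *)
Let connecting (c : limit C) (w : limit (godement_coker A)) : Prop :=
  exists (b : product B) (u : product (godement A)) (v : product A),
    [/\ forall p, g p (b p) = subgroup_val c p,
        forall p, godement_pi A p (u p) = subgroup_val w p
      & forall p q (h : (p <= q)%O),
          i q (coord_at h (u p) + v q) = fmap B h (b p) - b q].

Let connectingB c w c' w' :
  connecting c w -> connecting c' w' -> connecting (c - c') (w - w').
Proof.
move=> [b [u [v [bc uw vb]]]] [b' [u' [v' [bc' uw' vb']]]].
exists (b - b'), (u - u'), (v - v'); split=> [p|p|p q h].
- by rewrite raddfB bc bc'.
- by rewrite raddfB uw uw'.
rewrite !productBE coord_atB addrACA -opprD !raddfB vb vb'.
by rewrite !opprD addrACA.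
Qed.

Let connecting_total c : exists w, connecting c w.
Proof.
have /dependent_choice[b bc] (p : P) : exists b, g p b = subgroup_val c p.
  exact: (short_exact_epi ig).
have ex p q (h : (p <= q)%O) : exists a, i q a = fmap B h (b p) - b q.
  by apply/(short_exact_mid ig); rewrite raddfB ncomp_natural !bc (limitP c) subrr.
pose u p : godement A p := of_coord_at (fun q h => sval (cid (ex p q h))).
have uE p q (h : (p <= q)%O) : i q (coord_at h (u p)) = fmap B h (b p) - b q.
  by rewrite of_coord_atK; case: cid.
have w_compat : is_compatible (fun p => godement_pi A p (u p)).
  move=> p p' hp; rewrite -ncomp_natural; apply/eqP; rewrite -subr_eq0 -raddfB.
  apply/eqP/godement_piP; exists (coord_at hp (u p)); apply: coord_at_ext => q h.
  apply: (short_exact_mono ig); have h' := le_trans hp h.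
  rewrite coord_at_unit coord_atB (coord_at_map _ _ h') raddfB !uE.
  rewrite ncomp_natural uE raddfB -(fmap_comp hp h h') opprB addrA.
  by rewrite addrNK.
exists (subgroup_elt (S := compatible (godement_coker A)) w_compat).
by exists b, u, 0; split=> // p q h; rewrite addr0.
Qed.

Let connecting_surj w : exists c, connecting c w.
Proof.
have /dependent_choice[u uw] (p : P) : exists u, godement_pi A p u = subgroup_val w p.
  exact: godement_pi_surj.
have [t tw] := B_acyclic (limit_map (godement_coker_map i) w).
have [e te] := limit_godementP t.
have /dependent_choice[b bE] (p : P) : exists b,
    godement_unit B p b = godement_map i p (u p) - subgroup_val t p.
  apply/godement_piP; rewrite raddfB -godement_coker_mapE uw.
  have := congr1 (fun z : limit _ => subgroup_val z p) tw; rewrite !limit_mapE => ->.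
  exact: subrr.
have eq_uv p q (h : (p <= q)%O) :
    i q (coord_at h (u p) + - coord_at (lexx q) (u q)) = fmap B h (b p) - b q.
  rewrite -(fmap_id (lexx q) (b q)) -!coord_at_unit !bE !coord_atB !te.
  by rewrite !coord_at_godement_map raddfB opprB addrA addrNK.
have c_compat : is_compatible (fun p => g p (b p)).
  move=> p q h; apply/eqP; rewrite -subr_eq0 -ncomp_natural -raddfB; apply/eqP.
  by apply/(short_exact_mid ig); rewrite -eq_uv; eexists.
exists (subgroup_elt (S := compatible C) c_compat).
by exists b, u, (fun q => - coord_at (lexx q) (u q)); split.
Qed.

Let connecting_image c w : connecting c w ->
  (Defs.image (limit_map g) c <-> Defs.image (limit_map (godement_pi A)) w).
Proof.
move=> [b [u [v [bc uw vb]]]]; split=> [[b'' bE]|[s sw]].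
  have /dependent_choice[a aE] (p : P) : exists a, i p a = b p - subgroup_val b'' p.
    by apply/(short_exact_mid ig); rewrite raddfB bc -bE limit_mapE subrr.
  have [s sE] := limit_godement (fun p => - (a p + v p) : A p).
  exists s; apply: limit_ext => p.
  rewrite limit_mapE -uw; apply/eqP; rewrite -subr_eq0 -raddfB; apply/eqP/godement_piP.
  exists (- a p); apply: coord_at_ext => q h; apply: (short_exact_mono ig).
  rewrite coord_at_unit coord_atB sE -opprD !raddfN; congr (- _).
  rewrite -addrA [v q + _]addrC raddfD vb ncomp_natural !aE raddfB (limitP b'').
  by rewrite [RHS]addrC addrA subrK.
have [t sE] := limit_godementP s.
have /dependent_choice[a aE] (p : P) : exists a, godement_unit A p a = u p - subgroup_val s p.
  by apply/godement_piP; rewrite raddfB uw -sw limit_mapE subrr.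
have uE p q (h : (p <= q)%O) : coord_at h (u p) = fmap A h (a p) + t q.
  by rewrite -coord_at_unit aE coord_atB sE subrK.
have a0 q : a q + t q + v q = 0.
  apply: (short_exact_mono ig); rewrite raddf0.
  have := vb q q (lexx q); rewrite uE !fmap_id => ->; exact: subrr.
have b_compat : is_compatible (fun p => b p - i p (a p)).
  move=> p q h.
  have e : i q (fmap A h (a p)) - i q (a q) = fmap B h (b p) - b q.
    rewrite -vb uE -raddfB -addrA; congr (i q (_ + _)).
    by apply/esym/eqP; rewrite -addr_eq0 addrAC [t q + _]addrC a0.
  rewrite raddfB -ncomp_natural; apply/eqP.
  by rewrite subr_eq -addrA [- _ + _]addrC e addrC subrK.
exists (subgroup_elt (S := compatible B) b_compat).
apply: limit_ext => p; rewrite limit_mapE /= raddfB bc.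
rewrite (_ : g p _ = 0) ?subr0 //.
by apply/(short_exact_mid ig); exists (a p).
Qed.

Lemma connecting_isom : zmod_isom (quotient (Defs.image (limit_map g))) (lim1 A).
Proof.
exact: (@quotient_isom _ _ _ _ connecting).
Qed.

Lemma lim1_godement_coker :
  zmod_isom (lim1 C) (quotient (Defs.image (limit_map (godement_coker_map g)))).
Proof.
apply: (@quotient_isom _ _ _ _ eq) => [? ? ? ? -> -> //|c|c|c _ <-]; try by exists c.
split=> [[x <-]|[y <-]].
  have [z zx] := limit_godementP x.
  have /dependent_choice[b bz] (p : P) : exists b, g p b = z p.
    exact: (short_exact_epi ig).
  have [t tb] := limit_godement b.
  exists (limit_map (godement_pi B) t); apply: limit_ext => p.
  rewrite !limit_mapE godement_coker_mapE; congr (godement_pi C p _).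
  by apply: coord_at_ext => q h; rewrite coord_at_godement_map tb zx bz.
have [t <-] := B_acyclic y; exists (limit_map (godement_map g) t).
by apply: limit_ext => p; rewrite !limit_mapE godement_coker_mapE.
Qed.

End Connecting.

End Godement.

Section Acyclic.
Variables (disp : Order.disp_t) (P : porderType disp).
Implicit Types A B C : functor P.

Notation Q := (@godement_coker disp P).

Definition lim_acyclic A : Prop := forall k, limit_epi (godement_pi (iter k Q A)).

Lemma iter_short_exact k A B C (i : nattrans A B) (g : nattrans B C) :
  short_exact i g -> exists (i' : nattrans (iter k Q A) (iter k Q B))
    (g' : nattrans (iter k Q B) (iter k Q C)), short_exact i' g'.
Proof.
move=> ig; elim: k => [|k [i' [g' ig']]]; first by exists i, g.
exists (godement_coker_map i'), (godement_coker_map g').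
exact: godement_coker_short_exact.
Qed.

(* Injectivity relative to the pointwise split monomorphisms *)
Definition godement_split A : Prop :=
  exists r : nattrans (godement A) A, forall p a, r p (godement_unit A p a) = a.

Section Split.
Variables (A : functor P) (r : nattrans (godement A) A).
Hypothesis rK : forall p a, r p (godement_unit A p a) = a.

Lemma godement_split_epi : limit_epi (godement_pi A).
Proof.
move=> y.
have /dependent_choice[x xy] (p : P) : exists x, godement_pi A p x = subgroup_val y p.
  exact: godement_pi_surj.
have x_compat : is_compatible (fun p => x p - godement_unit A p (r p (x p))).
  move=> p q h.
  have [a ax] : exists a, godement_unit A q a = fmap (godement A) h (x p) - x q.
    by apply/godement_piP; rewrite raddfB ncomp_natural !xy limitP subrr.
  have e : fmap (godement A) h (x p) = x q + godement_unit A q a.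
    by rewrite ax addrC subrK.
  by rewrite raddfB -!ncomp_natural e raddfD rK raddfD opprD addrACA subrr addr0.
exists (subgroup_elt (S := compatible (godement A)) x_compat).
apply: limit_ext => p; rewrite limit_mapE /= raddfB xy.
rewrite (_ : godement_pi A p (godement_unit A p _) = 0) ?subr0 //.
by apply/godement_piP; eexists.
Qed.

Let section_fun p (y : Q A p) : godement A p :=
  sval (cid (godement_pi_surj y))
  - godement_unit A p (r p (sval (cid (godement_pi_surj y)))).

Let section_funE p x :
  section_fun (godement_pi A p x) = x - godement_unit A p (r p x).
Proof.
rewrite /section_fun; set x' := sval _.
have /eqP : godement_pi A p x' = godement_pi A p x := svalP (cid (godement_pi_surj _)).
rewrite -subr_eq0 -raddfB => /eqP/godement_piP[a ax].
have -> : x' = x + godement_unit A p a.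
  by rewrite ax addrC subrK.
by rewrite raddfD rK raddfD opprD addrACA subrr addr0.
Qed.

Let section_additive p : zmod_morphism (@section_fun p).
Proof.
move=> y z; have [x <-] := godement_pi_surj y; have [x' <-] := godement_pi_surj z.
rewrite -raddfB !section_funE.
by rewrite [r p _]raddfB [godement_unit A p _]raddfB !opprD [RHS]addrACA.
Qed.

Let section_natural p q (h : (p <= q)%O) y :
  additive_of (@section_additive q) (fmap (Q A) h y) =
  fmap (godement A) h (additive_of (@section_additive p) y).
Proof.
have [x <-] := godement_pi_surj y.
rewrite -ncomp_natural; apply: etrans (section_funE _) _.
have -> : additive_of (@section_additive p) (godement_pi A p x) =
  x - godement_unit A p (r p x) := section_funE x.
by rewrite raddfB -!ncomp_natural.
Qed.

Let section : nattrans (Q A) (godement A) := NatTrans section_natural.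

Let diagonal_fun p (x : godement (godement A) p) : godement A p :=
  of_coord_at (fun q h => coord_at (lexx q) (coord_at h x)).

Let diagonal_additive p : zmod_morphism (@diagonal_fun p).
Proof. by move=> x y; apply: coord_at_ext => q h; rewrite coord_atB !of_coord_atK. Qed.

Let diagonal_natural p q (h : (p <= q)%O) x :
  additive_of (@diagonal_additive q) (fmap (godement (godement A)) h x) =
  fmap (godement A) h (additive_of (@diagonal_additive p) x).
Proof.
apply: coord_at_ext => s hs; have h' := le_trans h hs.
by rewrite (coord_at_map _ _ h') !additive_ofE !of_coord_atK (coord_at_map _ _ h').
Qed.

Lemma godement_split_coker : godement_split (Q A).
Proof.
exists (nt_comp (godement_pi A) (nt_comp (NatTrans diagonal_natural) (godement_map section))).
move=> p y; have [x <-] := godement_pi_surj y.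
have -> : nt_comp (godement_pi A) (nt_comp (NatTrans diagonal_natural)
    (godement_map section)) p (godement_unit (Q A) p (godement_pi A p x)) =
    godement_pi A p (section p (godement_pi A p x)).
  congr (godement_pi A p _).
  rewrite -[LHS]/(diagonal_fun (godement_map section p
    (godement_unit _ p (godement_pi A p x)))).
  rewrite godement_map_unit.
  apply: coord_at_ext => q h; rewrite of_coord_atK coord_at_unit.
  by rewrite (coord_at_map _ _ h).
rewrite [section p _]section_funE raddfB
  (_ : godement_pi A p (godement_unit A p _) = 0) ?subr0 //.
by apply/godement_piP; eexists.
Qed.

End Split.

Lemma godement_split_acyclic A : godement_split A -> lim_acyclic A.
Proof.
move=> A_split k; have [r rK] : godement_split (iter k Q A).
  by elim: k => //= k [r rK]; apply: godement_split_coker rK.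
exact: godement_split_epi rK.
Qed.

Lemma injective_split A : injective_functor A -> godement_split A.
Proof.
move=> A_inj.
have id_natural (p q : P) (h : (p <= q)%O) x :
    [the {additive A q -> A q} of idfun] (fmap A h x) =
    fmap A h ([the {additive A p -> A p} of idfun] x) by [].
have [r rP] := A_inj _ _ _ (NatTrans id_natural) (@godement_unit_mono _ _ A).
by exists r => p a; rewrite rP.
Qed.

Section AboveProductSplit.
Variables (deg : P -> nat) (n : nat) (A : functor P).

Let retract_fun p (x : godement (above_product deg A n) p) : above_product deg A n p :=
  of_acoord (fun q h =>
    acoord (introT andP (conj (lexx q) (andP h).2)) (coord_at (andP h).1 x)).

Let retract_additive p : zmod_morphism (@retract_fun p).
Proof. by move=> x y; apply: acoord_ext => q h; rewrite acoordB !of_acoordK. Qed.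

Let retract_natural p q (h : (p <= q)%O) x :
  additive_of (@retract_additive q) (fmap (godement (above_product deg A n)) h x) =
  fmap (above_product deg A n) h (additive_of (@retract_additive p) x).
Proof.
apply: acoord_ext => s hs; have hs' : (p <= s)%O && (deg s == n).
  by have /andP[qs ->] := hs; rewrite (le_trans h qs).
rewrite (acoord_map _ _ hs') !additive_ofE !of_acoordK (coord_at_map _ _ (andP hs').1).
exact: acoord_irr.
Qed.

Lemma above_product_split : godement_split (above_product deg A n).
Proof.
exists (NatTrans retract_natural) => p a; apply: acoord_ext => q h.
by rewrite additive_ofE of_acoordK coord_at_unit (acoord_map _ _ h).
Qed.

End AboveProductSplit.

Section Resolution.
Variables (A B : nat -> functor P) (i : forall n, nattrans (A n) (B n))
  (g : forall n, nattrans (B n) (A n.+1)).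
Hypotheses (ig : forall n, short_exact (i n) (g n)) (B_acyclic : forall n, lim_acyclic (B n)).

Lemma lim1_dimension_shift n k :
  zmod_isom (lim1 (iter k Q (A n))) (lim1 (iter (k + n) Q (A 0%N))).
Proof.
elim: n k => [|n IHn] k; first by rewrite addn0; exists idfun; exists idfun.
have [i' [g' ig']] := iter_short_exact k (ig n).
rewrite -addSnnS; apply: (zmod_isom_trans _ (IHn k.+1)).
apply: (zmod_isom_trans (lim1_godement_coker ig' (@B_acyclic n k))).
exact: connecting_isom (godement_coker_short_exact ig') (@B_acyclic n k.+1).
Qed.

Let limit_diff n : {additive limit (B n) -> limit (B n.+1)} :=
  limit_map (nt_comp (i n.+1) (g n)).

Let limit_diffE n x : limit_diff n x = limit_map (i n.+1) (limit_map (g n) x).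
Proof. exact: limit_ext. Qed.

Let limit_giK n x : limit_map (g n) (limit_map (i n) x) = 0.
Proof.
apply: limit_ext => p; rewrite !limit_mapE.
by apply/(short_exact_mid (ig n)); exists (subgroup_val x p).
Qed.

Lemma transport_limit_complex (U : nat -> zmodType)
    (theta : forall n, {additive limit (B n) -> U n}) :
    (forall n, bijective (theta n)) ->
  exists (d : forall n, {additive U n -> U n.+1}) (dK : forall n x, d n.+1 (d n x) = 0),
  forall n x, differential (CochainComplex dK) n (theta n x) =
    theta n.+1 (limit_map (nt_comp (i n.+1) (g n)) x).
Proof.
move=> theta_bij.
have /dependent_choice[d dE] n : exists f : {additive U n -> U n.+1},
    forall x, f (theta n x) = theta n.+1 (limit_diff n x).
  have [f thetaK fK] := theta_bij n.
  exists (theta n.+1 \o (limit_diff n \o additive_of (can2_zmod_morphism thetaK fK))).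
  by move=> x; rewrite -[LHS]/(theta n.+1 (limit_diff n (f (theta n x)))) thetaK.
have dK n x : d n.+1 (d n x) = 0.
  have [f _ fK] := theta_bij n.
  by rewrite -[x]fK !dE !limit_diffE limit_giK !raddf0.
by exists d, dK.
Qed.

(* K is, up to the isomorphisms theta, the complex lim (B 0) -> lim (B 1) -> ... *)
Variables (K : cochain_complex) (theta : forall n, {additive limit (B n) -> K n}).
Hypotheses (theta_bij : forall n, bijective (theta n))
  (thetaP : forall n x, differential K n (theta n x) =
     theta n.+1 (limit_map (nt_comp (i n.+1) (g n)) x)).

Let cocycle_rel n (z : subgroup_type (cocycles K n)) (a : limit (A n)) : Prop :=
  theta n (limit_map (i n) a) = subgroup_val z.

Let cocycle_relB n z a z' a' :
  @cocycle_rel n z a -> cocycle_rel z' a' -> cocycle_rel (z - z') (a - a').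
Proof. by rewrite /cocycle_rel => za za'; rewrite !raddfB za za'. Qed.

Let cocycle_rel_total n z : exists a, @cocycle_rel n z a.
Proof.
have [tau thetaK tauK] := theta_bij n.
have dz : differential K n (subgroup_val z) = 0.
  exact/(subgroup_predP (cocycles K n))/subgroup_valP.
have := thetaP (tau (subgroup_val z)); rewrite tauK dz => /esym.
have [tau' thetaK' _] := theta_bij n.+1.
rewrite -[RHS](raddf0 (theta n.+1)) => /(can_inj thetaK') gz.
have /dependent_choice[a aE] (p : P) :
    exists a, i n p a = subgroup_val (tau (subgroup_val z)) p.
  apply/(short_exact_mid (ig n)); apply: (short_exact_mono (ig n.+1)).
  have := congr1 (fun x : limit _ => subgroup_val x p) gz.
  by rewrite limit_mapE /= raddf0.
have a_compat : is_compatible a.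
  move=> p q h; apply: (short_exact_mono (ig n)).
  by rewrite ncomp_natural !aE limitP.
exists (subgroup_elt (S := compatible (A n)) a_compat).
rewrite /cocycle_rel -[RHS]tauK; congr (theta n _).
by apply: limit_ext => p; rewrite limit_mapE aE.
Qed.

Let cocycle_rel_surj n a : exists z, @cocycle_rel n z a.
Proof.
have dz : cocycles K n (theta n (limit_map (i n) a)).
  rewrite /= thetaP -[RHS](raddf0 (theta n.+1)); congr (theta n.+1 _).
  apply: limit_ext => p; rewrite !limit_mapE /= -[RHS](raddf0 (i n.+1 p)).
  congr (i n.+1 p _); apply/(short_exact_mid (ig n)).
  by exists (subgroup_val a p).
by exists (subgroup_elt dz).
Qed.

Let limit_map_mono n : injective (limit_map (i n)).
Proof.
move=> a a' aa'; apply: limit_ext => p; apply: (short_exact_mono (ig n)).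
by rewrite -!limit_mapE aa'.
Qed.

(* kernel idfun is the zero subgroup: the right-hand side is limit (A 0). *)
Lemma cohomology_limit0 :
  zmod_isom (cohomology K 0) (quotient (kernel [the {additive limit (A 0%N) -> _} of idfun])).
Proof.
apply: (@quotient_isom _ _ _ _ (@cocycle_rel 0)) => [|||z a za].
- exact: cocycle_relB.
- exact: cocycle_rel_total.
- exact: cocycle_rel_surj.
rewrite /= -za; split=> [|->]; last by rewrite !raddf0.
have [tau thetaK _] := theta_bij 0.
rewrite -[RHS](raddf0 (theta 0)) => /(can_inj thetaK).
by rewrite -[RHS](raddf0 (limit_map (i 0))) => /limit_map_mono.
Qed.

Lemma cohomology_limitS n : zmod_isom (cohomology K n.+1) (lim1 (iter n Q (A 0%N))).
Proof.
apply: (zmod_isom_trans _ (lim1_dimension_shift n 0)).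
apply: (zmod_isom_trans _ (connecting_isom (ig n) (@B_acyclic n 0))).
apply: (@quotient_isom _ _ _ _ (@cocycle_rel n.+1)) => [|||z a za].
- exact: cocycle_relB.
- exact: cocycle_rel_total.
- exact: cocycle_rel_surj.
have [tau thetaK tauK] := theta_bij n; have [tau' thetaK' _] := theta_bij n.+1.
have igE := @limit_diffE n.
rewrite /= -za; split=> [[y]|[x <-]]; last by exists (theta n x); rewrite thetaP igE.
rewrite -[y]tauK thetaP igE => /(can_inj thetaK')/limit_map_mono <-.
by exists (tau y).
Qed.

End Resolution.

End Acyclic.

Lemma fsum_seq (T : choiceType) (s : seq T) (A : set T) (f : T -> int) :
  uniq s -> (forall x, A x -> x \in s) ->
  \sum_(x \in A) f x = \sum_(x <- s | x \in A) f x.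
Proof.
move=> us As; rewrite (fsbigE [seq x <- s | x \in A]) ?filter_uniq //.
- by rewrite big_filter_cond; apply: eq_bigl => x; rewrite andbb.
- by move=> x; rewrite /= mem_filter => /andP[/set_mem].
- by move=> x Ax; rewrite mem_filter mem_set // As.
Qed.

(* The point q is counted once on the left and as often as it is covered on the
   right; with nonnegative weights equality forces the cover to be exact. *)
Lemma exact_weighted_cover (T : eqType) (s : seq T) (w : T -> int)
    (e : pred T) (c : T -> pred T) :
    uniq s ->
    {in s, forall q, e q -> has (fun p => c p q) s} ->
    {in s &, forall p q, c p q -> 0 <= w q} ->
    \sum_(q <- s | e q) w q = \sum_(p <- s) \sum_(q <- s | c p q) w q ->
  {in s &, forall p q, c p q -> w q != 0 ->
     e q /\ {in s, forall p', c p' q -> p' = p}}.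
Proof.
move=> us cover w_ge0; pose N q := count (fun p => c p q) s.
have -> : \sum_(p <- s) \sum_(q <- s | c p q) w q = \sum_(q <- s) w q *+ N q.
  rewrite (exchange_big_dep predT) //=; apply: eq_bigr => q _.
  by rewrite big_const_seq iter_addr_0.
rewrite big_mkcond /= => /esym/eqP; rewrite -subr_eq0 -sumrB big_seq psumr_eq0; last first.
  move=> q qs; case: ifP => [eq|_].
    have Nq : (0 < N q)%N by rewrite -has_count cover.
    have [p ps cpq] := hasP (cover q qs eq).
    by rewrite -[X in _ - X]mulr1n -mulrnBr // mulrn_wge0 // (w_ge0 p).
  rewrite subr0; have [N0|] := posnP (N q); first by rewrite N0.
  by rewrite -has_count => /hasP[p ps cpq]; rewrite mulrn_wge0 // (w_ge0 p).
move=> /allP N_eq p q ps qs cpq wq0.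
have Nq : (0 < N q)%N by rewrite -has_count; apply/hasP; exists p.
have := N_eq q qs; rewrite qs /= subr_eq0.
have -> : (if e q then w q else 0) = w q *+ (e q) by case: (e q).
move=> /eqP/(mulrIn wq0) NE.
have eq : e q by rewrite NE in Nq; case: (e q) Nq.
split=> // p' p's cp'q; move: NE; rewrite eq /N -size_filter /=.
have : p \in [seq p <- s | c p q] by rewrite mem_filter cpq.
have : p' \in [seq p <- s | c p q] by rewrite mem_filter cp'q.
by case: [seq _ <- _ | _] => [|x [|]] //; rewrite !inE => /eqP -> /eqP ->.
Qed.

Section Diagonal.
Variables (disp : Order.disp_t) (P : porderType disp) (deg : P -> nat).
Hypothesis deg_graded : graded deg.

Lemma above_seq (p0 : P) : exists2 s : seq P, uniq s & forall p, (p \in s) = (p0 <= p)%O.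
Proof.
have /finite_seqP[s sE] := graded_finite deg_graded p0.
exists (undup s) => [|p]; first exact: undup_uniq.
by rewrite mem_undup; apply/idP/idP; have := congr1 (fun A => A p) sE => /= ->.
Qed.

Lemma graded_strict (p q : P) : (p < q)%O -> (deg q < deg p)%N.
Proof.
have [s us sE] := above_seq p.
have [m] := ubnP (count (fun r => (p < r <= q)%O) s).
elim: m q => // m IHm q /ltnSE le_m pq.
have [pq_prec|/not_andP[//|]] := pselect (precedes p q).
  by rewrite (graded_precedes deg_graded pq_prec).
move=> /existsNP[r /not_implyP[pr /not_implyP[rq /not_orP[/eqP rp /eqP rq']]]].
have {}pr : (p < r)%O by rewrite lt_neqAle eq_sym rp.
apply: leq_ltn_trans (graded_anti deg_graded rq) (IHm r _ pr).
apply: leq_trans le_m; rewrite -!size_filter.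
have qr : (q <= r)%O = false by apply/negP => qr; case/eqP: rq'; apply/eqP; rewrite eq_le rq.
have sub : {subset q :: [seq x <- s | (p < x <= r)%O] <= [seq x <- s | (p < x <= q)%O]}.
  move=> x; rewrite inE !mem_filter => /orP[/eqP->|/andP[/andP[-> xr] ->]].
    by rewrite pq lexx sE ltW.
  by rewrite (le_trans xr rq).
apply: uniq_leq_size sub.
by rewrite /= mem_filter qr !andbF /= filter_uniq.
Qed.

Lemma Fseq_eq0 n (p : P) : (deg p < n)%N -> forall x : Fseq deg n p, x = 0.
Proof.
case: n => // n; rewrite ltnS => le_pn x.
have [y <-] := to_quotient_surj (x : quotient _); apply/to_quotient_eq0.
have [lt_pn|eq_pn] := boolP (deg p < n)%N.
  exists 0; rewrite raddf0; apply: acoord_ext => q h.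
  have /andP[pq /eqP dq] := h.
  by have := graded_anti deg_graded pq; rewrite dq leqNgt lt_pn.
have {eq_pn le_pn} dp : deg p == n by rewrite eqn_leq le_pn leqNgt eq_pn.
have hp : (p <= p)%O && (deg p == n) by rewrite lexx.
exists (acoord hp y); apply: acoord_ext => q h; have /andP[pq /eqP dq] := h.
rewrite (acoord_diagonal _ pq); have qp : q = p.
  apply/eqP/negPn/negP => qp.
  have := @graded_strict p q; rewrite lt_neqAle eq_sym qp pq => /(_ isT).
  by rewrite dq (eqP dp) ltnn.
by subst q; rewrite fmap_id; apply: acoord_irr.
Qed.

Variable J : P -> nat -> set P.
Hypotheses (J_covering : local_covering_family deg J) (J_adequate : adequate deg J).

Let J_above p0 n p : (n <= deg p0)%N -> J p0 n p -> (p0 <= p)%O && (deg p == n).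
Proof. by move=> np0 /(covering_sub J_covering np0)[-> /eqP]. Qed.

Let complement p0 n : set P := [set q | above_deg deg p0 n q /\ ~ J p0 n q].

Lemma Rnum_complement n (p0 : P) (s : seq P) : (n < deg p0)%N -> uniq s ->
  {subset (fun q => (p0 <= q)%O) <= s} ->
  Rnum deg n.+1 p0 = \sum_(q <- s | q \in complement p0 n) Rnum deg n q.
Proof.
move=> np0 us sP; rewrite /= (adequate_rank J_adequate np0).
rewrite !(fsum_seq (s := s)) //; last first.
- by move=> q /(J_above (ltnW np0))/andP[p0q _]; apply: sP.
- by move=> q [p0q _]; apply: sP.
rewrite (bigID (fun q => q \in J p0 n)) /= addrC.
set X := \sum_(q <- s | _ && ~~ _) _; set Y := \sum_(q <- s | _ && _) _.
have -> : Y = \sum_(q <- s | q \in J p0 n) Rnum deg n q.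
  apply: eq_bigl => q; apply/andP/idP => [[]//|Jq]; split=> //.
  by apply/mem_set/(covering_sub J_covering (ltnW np0))/set_mem.
rewrite addrK; apply: eq_bigl => q; apply/andP/idP => [[qa /negP qJ]|].
  by apply/mem_set; split; [apply: set_mem | move=> /mem_set].
move=> /set_mem[qa qJ]; split; first exact: mem_set.
by apply/negP => /set_mem.
Qed.

Let restriction_bij n p0 : Prop :=
  (forall x : Fseq deg n p0,
     (forall q (h : (p0 <= q)%O && (deg q == n)),
        J p0 n q -> acoord h (above_diagonal deg (Fseq deg n) n p0 x) = 0) -> x = 0) /\
  (forall z : above_product deg (Fseq deg n) n p0, exists x : Fseq deg n p0,
     forall q (h : (p0 <= q)%O && (deg q == n)),
        J p0 n q -> acoord h (above_diagonal deg (Fseq deg n) n p0 x) = acoord h z).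

Let rank_ok n p0 : Prop :=
  0 <= Rnum deg n p0 /\ (Rnum deg n p0 = 0 -> forall x : Fseq deg n p0, x = 0).

Let Fpi n : nattrans (above_product deg (Fseq deg n) n) (Fseq deg n.+1) :=
  nt_to_coker (above_diagonal deg (Fseq deg n) n).

Let normalized n p0 (y : above_product deg (Fseq deg n) n p0) : Prop :=
  forall q (h : (p0 <= q)%O && (deg q == n)), J p0 n q -> acoord h y = 0.

Let normalized_lift n p0 : restriction_bij n p0 ->
  forall x, exists2 y, Fpi n p0 y = x & normalized y.
Proof.
move=> [_ surj] x; have [y <-] := to_quotient_surj (x : quotient _).
have [a aP] := surj y.
exists (y - above_diagonal deg (Fseq deg n) n p0 a).
  rewrite raddfB (_ : Fpi n p0 (above_diagonal _ _ _ _ _) = 0) ?subr0 //.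
  by apply/to_quotient_eq0; exists a.
by move=> q h Jq; rewrite acoordB aP // subrr.
Qed.

Let step_rank n : (forall p, (n <= deg p)%N -> rank_ok n p) ->
    (forall p, (n < deg p)%N -> restriction_bij n p) ->
  forall p0, (n < deg p0)%N -> rank_ok n.+1 p0.
Proof.
move=> rk bij p0 np0; have [s us sE] := above_seq p0.
have ge0 q : q \in complement p0 n -> 0 <= Rnum deg n q.
  by move=> /set_mem[[_ dq] _]; apply: (rk q _).1; rewrite dq.
rewrite /rank_ok (Rnum_complement np0 us); last by move=> q; rewrite sE.
split=> [|/eqP]; first by rewrite sumr_ge0.
rewrite psumr_eq0 // => /allP R0 x.
have [y <- y_norm] := normalized_lift (bij p0 np0) x.
suff -> : y = 0 by rewrite raddf0.
apply: acoord_ext => q h; have [Jq|Jq] := pselect (J p0 n q); first exact: y_norm.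
have /andP[p0q /eqP dq] := h.
apply: (rk q _).2; first by rewrite dq.
apply/eqP; have := R0 q; rewrite sE p0q => /(_ isT)/implyP; apply.
exact/mem_set.
Qed.

Let step_inj n : (forall p, (n < deg p)%N -> restriction_bij n p) ->
  forall p0, (n.+1 < deg p0)%N ->
  forall x : Fseq deg n.+1 p0,
    (forall q (h : (p0 <= q)%O && (deg q == n.+1)), J p0 n.+1 q ->
       acoord h (above_diagonal deg (Fseq deg n.+1) n.+1 p0 x) = 0) -> x = 0.
Proof.
move=> bij p0 np0 x x0; have np0' := ltnW np0.
have [y yx y_norm] := normalized_lift (bij p0 np0') x.
suff y0 : y = 0 by rewrite -yx y0 raddf0.
apply: acoord_ext => q h; have /andP[p0q /eqP dq] := h.
have : above_deg deg p0 n q by [].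
rewrite -(covering_cover J_covering np0') => -[p Jp [pq _]].
have hp := J_above np0' Jp; have /andP[p0p /eqP dp] := hp.
have hq : (p <= q)%O && (deg q == n) by rewrite pq dq /=.
have := x0 p hp Jp; rewrite (acoord_diagonal _ p0p) -yx -ncomp_natural.
move=> /to_quotient_eq0[a aE].
have a0 : a = 0.
  apply: (bij p _).1; first by rewrite dp.
  move=> r hr Jr; rewrite aE.
  have Jr' := covering_trans J_covering np0' Jp Jr.
  by rewrite (acoord_map _ _ (J_above (ltnW np0') Jr')); apply: y_norm.
by rewrite -(acoord_map p0p hq) -aE a0 raddf0.
Qed.

Let step_surj n : (forall p, (n <= deg p)%N -> rank_ok n p) ->
    (forall p, (n < deg p)%N -> restriction_bij n p) ->
  forall p0, (n.+1 < deg p0)%N ->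
  forall z : above_product deg (Fseq deg n.+1) n.+1 p0, exists x : Fseq deg n.+1 p0,
    forall q (h : (p0 <= q)%O && (deg q == n.+1)), J p0 n.+1 q ->
      acoord h (above_diagonal deg (Fseq deg n.+1) n.+1 p0 x) = acoord h z.
Proof.
move=> rk bij p0 np0 z; have np0' := ltnW np0.
have /dependent_choice[Y YP] p : exists Y : above_product deg (Fseq deg n) n p,
    forall h : (p0 <= p)%O && (deg p == n.+1), Fpi n p Y = acoord h z /\ normalized Y.
  have [h|nh] := pselect (is_true ((p0 <= p)%O && (deg p == n.+1))); last first.
    by exists 0 => h; case: (nh h).
  have /andP[_ /eqP dp] := h.
  have [|Y Yz Yn] := normalized_lift (bij p _) (acoord h z); first by rewrite dp.
  by exists Y => h'; rewrite (acoord_irr h' h).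
have [s us sE] := above_seq p0.
have exact_cover : {in s &, forall p q,
    (p \in J p0 n.+1) && (q \in complement p n) -> Rnum deg n q != 0 ->
    q \in complement p0 n /\
    {in s, forall p', (p' \in J p0 n.+1) && (q \in complement p' n) -> p' = p}}.
  apply: exact_weighted_cover => //.
  - move=> q qs /set_mem[qa qJ].
    have := qa; rewrite -(covering_cover J_covering np0') => -[p Jp qp].
    apply/hasP; exists p; first by have /andP[+ _] := J_above np0' Jp; rewrite sE.
    rewrite mem_set //=; apply/mem_set; split=> // Jq; apply: qJ.
    exact: (covering_trans J_covering np0' Jp).
  - move=> p q _ _ /andP[_ /set_mem[[_ dq] _]]; apply: (rk q _).1; by rewrite dq.
  rewrite -Rnum_complement //; last by move=> q; rewrite sE.
  rewrite (adequate_rank J_adequate np0) (fsum_seq (s := s)) //; last first.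
    by move=> p /(J_above np0')/andP[]; rewrite sE.
  rewrite big_mkcond; apply: eq_big_seq => p ps /=.
  case: ifP => [Jp|_]; last by rewrite big_pred0.
  have /andP[p0p /eqP dp] := J_above np0' (set_mem Jp).
  rewrite -Rnum_complement ?dp // => q pq.
  by rewrite sE (le_trans p0p pq).
have agree q p p' (h : (p <= q)%O && (deg q == n)) (h' : (p' <= q)%O && (deg q == n)) :
    J p0 n.+1 p -> J p0 n.+1 p' -> acoord h (Y p) = acoord h' (Y p').
  move=> Jp Jp'; have hp := J_above np0' Jp; have hp' := J_above np0' Jp'.
  have /andP[p0p _] := hp; have /andP[p0p' _] := hp'.
  have [_ Yn] := YP p hp; have [_ Yn'] := YP p' hp'.
  have /andP[pq /eqP dq] := h; have /andP[pq' _] := h'.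
  have [R0|R0] := eqVneq (Rnum deg n q) 0.
    have Fq0 : forall x : Fseq deg n q, x = 0 by apply: (rk q _).2 => //; rewrite dq.
    exact: etrans (Fq0 _) (esym (Fq0 _)).
  have ps : p \in s by rewrite sE.
  have ps' : p' \in s by rewrite sE.
  have qs : q \in s by rewrite sE (le_trans p0p pq).
  have counted r : J p0 n.+1 r -> above_deg deg r n q -> ~ J r n q ->
      (r \in J p0 n.+1) && (q \in complement r n).
    by move=> Jr rq nJ; rewrite mem_set //=; apply/mem_set.
  have [Jq|Jq] := pselect (J p n q); have [Jq'|Jq'] := pselect (J p' n q).
  - by rewrite (Yn q h Jq) (Yn' q h' Jq').
  - have [/set_mem[_ nJ] _] := exact_cover p' q ps' qs (counted p' Jp' (conj pq' dq) Jq') R0.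
    by case: nJ; apply: (covering_trans J_covering np0' Jp).
  - have [/set_mem[_ nJ] _] := exact_cover p q ps qs (counted p Jp (conj pq dq) Jq) R0.
    by case: nJ; apply: (covering_trans J_covering np0' Jp').
  - have [_] := exact_cover p q ps qs (counted p Jp (conj pq dq) Jq) R0.
    move=> /(_ p' ps' (counted p' Jp' (conj pq' dq) Jq')) pp'.
    by subst p'; apply: acoord_irr.
have ex q (h : (p0 <= q)%O && (deg q == n)) : exists v : Fseq deg n q,
    forall p (h' : (p <= q)%O && (deg q == n)), J p0 n.+1 p -> acoord h' (Y p) = v.
  have /andP[p0q /eqP dq] := h; have : above_deg deg p0 n q by [].
  rewrite -(covering_cover J_covering np0') => -[p Jp [pq _]].
  have hq : (p <= q)%O && (deg q == n) by rewrite pq dq /=.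
  by exists (acoord hq (Y p)) => p' h' Jp'; apply: agree.
pose y : above_product deg (Fseq deg n) n p0 :=
  of_acoord (fun q h => sval (cid (ex q h))).
exists (Fpi n p0 y) => p h Jp; have /andP[p0p _] := h.
rewrite (acoord_diagonal _ p0p) -ncomp_natural; have [<- _] := YP p h.
congr (Fpi n p _); apply: acoord_ext => q hq.
have hq' : (p0 <= q)%O && (deg q == n).
  by have /andP[pq ->] := hq; rewrite (le_trans p0p pq).
rewrite (acoord_map _ _ hq') of_acoordK; case: cid => v vP /=.
by rewrite (vP p hq Jp).
Qed.

Lemma Fseq_adequate n p0 :
  ((n <= deg p0)%N -> rank_ok n p0) /\ ((n < deg p0)%N -> restriction_bij n p0).
Proof.
elim: n p0 => [|n IHn] p0; last first.
  have rk p : (n <= deg p)%N -> rank_ok n p := (IHn p).1.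
  have bij p : (n < deg p)%N -> restriction_bij n p := (IHn p).2.
  by split=> np0; [apply: step_rank | split; [apply: step_inj | apply: step_surj]].
split=> [_|p0_gt0]; first by split.
have [s us sE] := above_seq p0.
have [p Jp] : exists p, J p0 0 = [set p]%classic.
  have := adequate_rank J_adequate p0_gt0; rewrite (fsum_seq _ us); last first.
    by move=> q /J_above; rewrite sE => /(_ isT)/andP[].
  rewrite big_const_seq iter_addr_0 /= => /(@mulrIn int 1 isT 1%N _).
  rewrite -size_filter; case Es: [seq _ <- _ | _] => [|p [|]] // _.
  exists p; apply/seteqP; split=> q /=.
    move=> Jq; have /J_above := Jq => /(_ isT)/andP[p0q _].
    have : q \in [seq x <- s | x \in J p0 0] by rewrite mem_filter mem_set // sE.
    by rewrite Es inE => /eqP.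
  move=> ->; have : p \in [seq x <- s | x \in J p0 0] by rewrite Es mem_head.
  by rewrite mem_filter => /andP[/set_mem].
have hp : (p0 <= p)%O && (deg p == 0%N) by apply: (@J_above p0 0%N) => //; rewrite Jp.
have /andP[p0p _] := hp.
split=> [x x0|z].
  by have := x0 p hp; rewrite (acoord_diagonal _ p0p) Jp => /(_ erefl).
exists (acoord hp z) => q h; rewrite Jp => qp; have {}qp : q = p := qp; subst q.
by rewrite (acoord_diagonal _ p0p); apply: acoord_irr.
Qed.

Lemma above_diagonal_mono n : nt_mono (above_diagonal deg (Fseq deg n) n).
Proof.
move=> p x x' xx'; apply/eqP; rewrite -subr_eq0; apply/eqP.
have {xx'} : above_diagonal deg (Fseq deg n) n p (x - x') = 0.
  by rewrite raddfB xx' subrr.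
move: (x - x') => {x x'}x x0.
have [np|] := ltnP n (deg p).
  by have [inj _] := (Fseq_adequate n p).2 np; apply: inj => q h _; rewrite x0.
rewrite leq_eqVlt => /orP[dp|]; last by move=> /Fseq_eq0; apply.
have hp : (p <= p)%O && (deg p == n) by rewrite lexx.
by have := congr1 (acoord hp) x0; rewrite (acoord_diagonal _ (lexx p)) fmap_id.
Qed.

End Diagonal.

Theorem theorem4p6 (disp : Order.disp_t) (P : porderType disp)
    (deg : P -> nat) (deg_graded : graded deg)
    (has_adequate : exists J : P -> nat -> set P,
       local_covering_family deg J /\ adequate deg J) :
  exists (d : forall n, {additive Fproduct deg n -> Fproduct deg n.+1})
         (dK : forall n x, d n.+1 (d n x) = 0),
  forall n, zmod_isom (cohomology (CochainComplex dK) n) (poset_cohomology P n).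
Proof.
have [J [J_covering J_adequate]] := has_adequate.
have diag_mono := above_diagonal_mono deg_graded J_covering J_adequate.
pose B n := above_product deg (Fseq deg n) n.
pose i n : nattrans (Fseq deg n) (B n) := above_diagonal deg (Fseq deg n) n.
pose g n : nattrans (B n) (Fseq deg n.+1) := nt_to_coker (i n).
have ig n : short_exact (i n) (g n) := nt_coker_short_exact (diag_mono n).
have B_acyclic n : lim_acyclic (B n).
  exact/godement_split_acyclic/above_product_split.
have /dependent_choice[theta theta_bij] n :
    exists f : {additive limit (B n) -> Fproduct deg n}, bijective f.
  exact: limit_above_product.
have [d [dK dE]] := transport_limit_complex ig theta_bij.
exists d, dK => n.
pose S := syzygy (constant_functor P int).
pose hull_exact m := nt_coker_short_exact (@hull_unit_mono _ _ (S m)).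
have hull_acyclic m : lim_acyclic (hull (S m)).
  exact/godement_split_acyclic/injective_split/hull_injective.
pose K := limit_complex (canonical_resolution (constant_functor P int)).
pose id_K m : {additive limit (hull (S m)) -> K m} :=
  [the {additive _ -> _} of idfun].
have id_bij m : bijective (id_K m) by exists idfun.
have idE m x : differential K m (id_K m x) = id_K m.+1 (limit_map
    (nt_comp (hull_unit (S m.+1))
       (nt_to_coker (hull_unit (S m)))) x) by [].
case: n => [|n].
  have h0 := cohomology_limit0 (K := CochainComplex dK) ig theta_bij dE.
  have h1 := cohomology_limit0 (A := S) (K := K) hull_exact id_bij idE.
  exact: zmod_isom_trans h0 (zmod_isom_sym h1).
have h0 := cohomology_limitS (K := CochainComplex dK) ig B_acyclic theta_bij dE n.
have h1 := cohomology_limitS (A := S) (K := K) hull_exact hull_acyclic id_bij idE n.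
exact: zmod_isom_trans h0 (zmod_isom_sym h1).
Qed.
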